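(* Let $\mathbb{F}$ be a field of constant characteristic $p$ (possibly $0$) and let $n\in\mathbb{N}$ be a growing parameter. Let $f\in s\mathcal{B}_n$ be arbitrary and let $(g,h)$ be a standard decomposition of $f$. Then for any $\varepsilon>0$: 1. If $\mathrm{per}(g)=1$ then $\mathrm{pdeg}^{\mathbb{F}}_\varepsilon(g)=0$. If $\mathrm{per}(g)$ is a power of $p$, then $\mathrm{pdeg}^{\mathbb{F}}_\varepsilon(g)\le \mathrm{per}(g)$. 2. $\mathrm{pdeg}^{\mathbb{F}}_\varepsilon(h)=\widetilde{O}\big(\sqrt{B(h)\log(1/\varepsilon)}+\log(1/\varepsilon)\big)$ if $B(h)\ge 1$, and $\mathrm{pdeg}^{\mathbb{F}}_\varepsilon(h)=0$ otherwise. 3. $\mathrm{pdeg}^{\mathbb{F}}_\varepsilon(f)$ is - $O(\sqrt{n\log(1/\varepsilon)})$ if $\mathrm{per}(g)>1$ and $\mathrm{per}(g)$ is not a power of $p$; - $O(\min\{\sqrt{n\log(1/\varepsilon)},\mathrm{per}(g)\})$ if $\mathrm{per}(g)$ is a power of $p$ and $B(h)=0$; - $\widetilde{O}\big(\min\{\sqrt{n\log(1/\varepsilon)},\ \mathrm{per}(g)+\sqrt{B(h)\log(1/\varepsilon)}+\log(1/\varepsilon)\}\big)$ otherwise. Here $\widetilde{O}(\cdot)$ hides factors polylogarithmic in $n$ (independent of $\varepsilon$). When $p>0$, all $\widetilde{O}(\cdot)$ above can be replaced by $O(\cdot)$.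
   Context: A probabilistic polynomial over $\mathbb{F}$ with error $\varepsilon$ for $f:\{0,1\}^n\to\{0,1\}$ is a random polynomial $\mathbf{P}\in\mathbb{F}[x_1,\dots,x_n]$ (finitely supported distribution) with $\Pr[\mathbf{P}(a)\ne f(a)]\le\varepsilon$ for every $a\in\{0,1\}^n$; its degree is at most $d$ if every polynomial in the support has degree at most $d$. $\mathrm{pdeg}^{\mathbb{F}}_\varepsilon(f)$ is the least such $d$. $s\mathcal{B}_n$ is the set of symmetric Boolean functions on $n$ variables; each $f\in s\mathcal{B}_n$ has a spectrum $\mathrm{Spec}\,f:[0,n]\to\{0,1\}$ with $f(a)=\mathrm{Spec}\,f(|a|)$ ($|a|$ = Hamming weight). $\mathrm{per}(f)$ is the smallest positive integer $b$ with $\mathrm{Spec}\,f(i)=\mathrm{Spec}\,f(i+b)$ for all $i\in[0,n-b]$. $f$ is $k$-bounded if $\mathrm{Spec}\,f$ is constant on $[k,n-k]$; $B(f)$ is the smallest such $k$. Standard decomposition: among all $f'\in s\mathcal{B}_n$ with $\mathrm{Spec}\,f'(i)=\mathrm{Spec}\,f(i)$ for all $i\in[\lceil n/3\rceil,\lfloor 2n/3\rfloor]$, choose $g$ with $\mathrm{per}(g)$ as small as possible (the periodic part), and let $h=f\oplus g$ (the bounded part); $(g,h)$ is a standard decomposition. ''A power of $p$'' means $p^k$ for an integer $k\ge 0$. Constants in $O(\cdot)$ may depend on $p$. *)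

(* Defs.v *)
From HB Require Import structures.
From mathcomp Require Import all_boot all_order all_algebra finmap.
From mathcomp Require Import boolp classical_sets reals exp.
From mathcomp Require Import mpoly.

Set Implicit Arguments.
Unset Strict Implicit.
Unset Printing Implicit Defensive.

Import Order.TTheory GRing.Theory Num.Theory.
Local Open Scope ring_scope.

(** * Symmetric Boolean functions *)

Definition cube (n : nat) := {ffun 'I_n -> bool}.
Definition boolfun (n : nat) := {ffun cube n -> bool}.

Section Symmetric.
Variable n : nat.
Implicit Types (a b : cube n) (f g h : boolfun n).
Local Open Scope nat_scope.

Definition weight a : nat := #|[set i | a i]|.

Definition symmetric_fun f : Prop := forall a b, weight a = weight b -> f a = f b.

(* The point (1, .., 1, 0, .., 0) of weight i is used as a representative of
   the weight i; only the values at i <= n are meaningful.  See [SpecE]. *)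
Definition Spec f (i : nat) : bool := f [ffun j : 'I_n => j < i].

Lemma SpecE f a : symmetric_fun f -> f a = Spec f (weight a).
Proof.
move=> symf; apply: symf; rewrite /weight.
have le_n : #|[set i | a i]| <= n by rewrite -[X in _ <= X]card_ord max_card.
set w := #|_| in le_n *.
rewrite -sum1dep_card (eq_bigl (fun i : 'I_n => i < w)); last by move=> i; rewrite ffunE.
by rewrite -(big_ord_widen n (fun=> 1) le_n) sum1_card card_ord.
Qed.

Definition is_period f (m : nat) : bool :=
  (0 < m) && [forall i : 'I_n.+1, (i + m <= n) ==> (Spec f i == Spec f (i + m))].

Lemma exists_period f : exists m, is_period f m.
Proof.
exists n.+1; apply/andP; split=> //; apply/forallP => i; apply/implyP.
by rewrite leqNgt addnS ltnS leq_addl.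
Qed.

Definition per f : nat := ex_minn (exists_period f).

(* When n < 2 k the range [k, n - k] is empty and the condition is vacuous. *)
Definition bounded f (k : nat) : bool :=
  [forall i : 'I_n.+1, forall j : 'I_n.+1,
     (k <= i <= n - k) ==> (k <= j <= n - k) ==> (Spec f i == Spec f j)].

Lemma exists_bounded f : exists k, bounded f k.
Proof.
exists n; apply/forallP => i; apply/forallP => j; rewrite subnn !leqn0.
apply/implyP => /andP[ni /eqP i0]; apply/implyP => /andP[nj /eqP j0].
by rewrite i0 j0.
Qed.

Definition Bd f : nat := ex_minn (exists_bounded f).

(* (n + 2) %/ 3 is the ceiling of n / 3. *)
Definition agree_middle f f' : Prop :=
  forall i, (n + 2) %/ 3 <= i <= (2 * n) %/ 3 -> Spec f' i = Spec f i.

Definition standard_decomposition f g h : Prop :=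
  [/\ symmetric_fun g, agree_middle f g,
      forall f', symmetric_fun f' -> agree_middle f f' -> per g <= per f'
    & h = [ffun a => f a (+) g a]].

End Symmetric.

(** * Probabilistic polynomials *)

Record prob_poly (R : realType) (F : fieldType) (n : nat) := ProbPoly {
  pmf :> {fsfun {mpoly F[n]} -> R with 0};
  pmf_ge0 : forall Q, 0 <= pmf Q;
  pmf_sum1 : \sum_(Q <- finsupp pmf) pmf Q = 1 }.

Section ProbabilisticDegree.
Variables (R : realType) (F : fieldType) (n : nat).
Implicit Types (P : prob_poly R F n) (Q : {mpoly F[n]}) (a : cube n).

Definition peval Q a : F := Q.@[fun i => (a i)%:R].

(* Pr[P(a) != f(a)] *)
Definition error_at P (f : boolfun n) a : R :=
  \sum_(Q <- finsupp P | peval Q a != (f a)%:R) P Q.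

(* [msize Q] is the total degree of Q plus one, and [msize 0 = 0]. *)
Definition degree_at_most P (d : nat) : Prop :=
  forall Q, Q \in finsupp P -> (msize Q <= d.+1)%N.

Definition has_prob_poly (eps : R) (f : boolfun n) (d : nat) : Prop :=
  exists P, degree_at_most P d /\ forall a, error_at P f a <= eps.

(* [pdegP] shows that the default value 0 is not used when 0 <= eps. *)
Definition pdeg (eps : R) (f : boolfun n) : nat :=
  xget 0%N [set d | has_prob_poly eps f d /\
    forall d', has_prob_poly eps f d' -> (d <= d')%N]%classic.

Let cube_ind (a : cube n) : {mpoly F[n]} :=
  \prod_(i < n) (if a i then 'X_i else 1 - 'X_i).

Let cube_indE a b : peval (cube_ind a) b = (b == a)%:R.
Proof.
rewrite /peval /cube_ind rmorph_prod /=.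
have E i : (if a i then 'X_i else 1 - 'X_i : {mpoly F[n]}).@[fun i => (b i)%:R]
    = (b i == a i)%:R.
  case: (a i); first by rewrite mevalXU; case: (b i).
  by rewrite mevalB meval1 mevalXU; case: (b i); rewrite ?subrr ?subr0.
rewrite (eq_bigr _ (fun i _ => E i)); have [->|neq] := eqVneq b a.
  by rewrite big1 // => i _; rewrite eqxx.
have [i nai] : exists i, b i != a i.
  apply/existsP; apply: contraNT neq; rewrite negb_exists => /forallP e.
  by apply/eqP/ffunP => i; apply/eqP; rewrite -[_ == _]negbK.
by rewrite (bigD1 i) //= (negPf nai) mul0r.
Qed.

Let interp (f : boolfun n) : {mpoly F[n]} := \sum_a (f a)%:R *: cube_ind a.

Let interpE f a : peval (interp f) a = (f a)%:R.
Proof.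
rewrite /peval /interp raddf_sum /= (bigD1 a) //= mevalZ.
have := cube_indE a a; rewrite /peval eqxx => ->; rewrite mulr1 big1 ?addr0 // => b nab.
rewrite mevalZ; have := cube_indE b a; rewrite /peval => ->.
by rewrite eq_sym (negPf nab) mulr0.
Qed.

Lemma has_prob_poly_exists eps f : 0 <= eps -> exists d, has_prob_poly eps f d.
Proof.
move=> eps0; pose Q := interp f.
pose D : {fsfun {mpoly F[n]} -> R with 0} := [fsfun Q' in [fset Q]%fset => 1 | 0].
have DE Q' : D Q' = (Q' == Q)%:R by rewrite fsfunE in_fset1; case: (Q' == Q).
have suppD : finsupp D = [fset Q]%fset.
  by apply/fsetP => Q'; rewrite mem_finsupp DE in_fset1; case: (Q' == Q);
    rewrite ?oner_eq0 ?eqxx.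
have D0 Q' : 0 <= D Q' by rewrite DE ler0n.
have D1 : \sum_(Q' <- finsupp D) D Q' = 1.
  by rewrite suppD big_seq_fset1 DE eqxx.
exists (msize Q), (ProbPoly D0 D1); split=> [Q'|a]; rewrite /= ?/error_at /=.
  by rewrite suppD in_fset1 => /eqP ->.
by rewrite suppD -big_filter big_filter big_mkcond big_seq_fset1 interpE eqxx.
Qed.

Lemma pdegP eps f : 0 <= eps -> has_prob_poly eps f (pdeg eps f) /\
  forall d, has_prob_poly eps f d -> (pdeg eps f <= d)%N.
Proof.
move=> eps0; rewrite /pdeg; case: xgetP => [d _ //|none]; exfalso.
have ex : exists d, `[< has_prob_poly eps f d >].
  by have [d ?] := has_prob_poly_exists f eps0; exists d; apply/asboolP.
case: (ex_minnP ex) => d /asboolP Pd mind; apply: (none d); split=> // d' Pd'.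
exact/mind/asboolP.
Qed.

End ProbabilisticDegree.

Definition has_characteristic (F : fieldType) (p : nat) : Prop :=
  if p is 0 then [pchar F] =i pred0 else p \in [pchar F].

Definition is_power_of (p m : nat) : Prop := exists k : nat, m = (p ^ k)%N.

(* log(1/eps), truncated at 0: this only matters for eps > 1, where the error
   condition is void and every probabilistic degree is 0. *)
Definition log_inv {R : realType} (eps : R) : R := Num.max 0 (ln eps^-1).

(* A polylogarithmic factor in n; the summand 1 keeps it positive at n = 1. *)
Definition polylog (R : realType) (c n : nat) : R := (1 + ln n%:R) ^+ c.

(* Main.v *)
Require Import Defs.
From mathcomp Require Import all_boot all_order all_algebra finmap.
From mathcomp Require Import boolp classical_sets reals sequences exp.
From mathcomp Require Import mpoly.
From mathcomp Require Import ring lra zify.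
Import Order.TTheory GRing.Theory Num.Theory.
Local Open Scope ring_scope.

Set Implicit Arguments.
Unset Strict Implicit.
Unset Printing Implicit Defensive.

(** Everything is derived from random "counters": tuples (E_j) of low-degree
    polynomials with E_j(a) = [|a| = j] for all j < k simultaneously, except
    with probability e^(-L).  Keep one literal of each consecutive pair.  By a
    Chernoff bound the weight i of the sample determines |a| up to an error
    w = O(sqrt (k L)), so if A_ij interpolates [t = j] on the window
    [2i - w, 2i + w] and (E'_i) is a counter for the sample, then
    E_j(a) = sum_i E'_i(a) A_ij(|a|) is a counter.  As the vector E' enters
    linearly, one step adds only 2w to the degree while halving k, and the
    costs sum up geometrically to O(sqrt (k L)) until k = O(L).

    For k = O(L) there are three ways to stop.  With k = n + 1 also n = O(L), and
    exact interpolation has degree n.  In any characteristic, further halvings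
    with k fixed cost O(L) each, and O(log n) of them exhaust the variables.
    In characteristic p > 0, a vote over O(L) copies of u^(p-1), for u a random
    sparse sum of variables, separates weights below k from weights of at least
    64 k; it multiplies an exact interpolation on [0, 64 k].

    If eps >= 1/2, a random constant is a good enough approximation. *)

(** * Degree of functions on the cube, and interpolation in the weight *)

Section Degree.
Variables (F : fieldType) (n : nat).
Implicit Types (u v : cube n -> F).

(** Only values on the cube matter, so degree is attached to functions and identities are checked
    pointwise. *)
Definition degle (d : nat) u : Prop :=
  exists Q : {mpoly F[n]}, (msize Q <= d.+1)%N /\ forall a, peval Q a = u a.

Lemma degle_ext d u v : (forall a, u a = v a) -> degle d u -> degle d v.
Proof. by move=> uv [Q [sQ eQ]]; exists Q; split=> // a; rewrite eQ uv. Qed.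

Lemma degle_leq d d' u : (d <= d')%N -> degle d u -> degle d' u.
Proof. by move=> dd' [Q [sQ eQ]]; exists Q; split=> //; apply: leq_trans sQ _. Qed.

Lemma degle_cst d c : degle d (fun=> c).
Proof.
exists c%:MP; split=> [|a]; last by rewrite /peval mevalC.
by rewrite msizeC; case: (c != 0).
Qed.

Lemma degleD d u v : degle d u -> degle d v -> degle d (fun a => u a + v a).
Proof.
move=> [P [sP eP]] [Q [sQ eQ]]; exists (P + Q); split=> [|a]; last first.
  by rewrite -eP -eQ /peval mevalD.
by apply: leq_trans (msizeD_le _ _) _; rewrite geq_max sP.
Qed.

Lemma degleM d e u v : degle d u -> degle e v -> degle (d + e) (fun a => u a * v a).
Proof.
move=> [P [sP eP]] [Q [sQ eQ]]; exists (P * Q); split=> [|a]; last first.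
  by rewrite -eP -eQ /peval mevalM.
have [->|P0] := eqVneq P 0; first by rewrite mul0r msize0.
have [->|Q0] := eqVneq Q 0; first by rewrite mulr0 msize0.
by rewrite msizeM // -addnS -[X in (_ <= X)%N]/((d.+1 + e.+1).-1) -!subn1 leq_sub2r // leq_add.
Qed.

Lemma degleZ d c u : degle d u -> degle d (fun a => c * u a).
Proof. by move=> du; rewrite -[d]add0n; apply: degleM => //; apply: degle_cst. Qed.

Lemma degleB d u v : degle d u -> degle d v -> degle d (fun a => u a - v a).
Proof.
move=> du dv; apply: (@degle_ext _ (fun a => u a + (-1) * v a)) => [a|].
  by rewrite mulN1r.
by apply: degleD => //; apply: degleZ.
Qed.

Lemma degle_sum d (I : Type) (r : seq I) (P : pred I) (u : I -> cube n -> F) :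
  (forall i, degle d (u i)) -> degle d (fun a => \sum_(i <- r | P i) u i a).
Proof.
move=> du; elim: r => [|i r IH].
  by apply: degle_ext (degle_cst d 0) => a; rewrite big_nil.
case Pi: (P i).
  by apply: degle_ext (degleD (du i) IH) => a; rewrite big_cons Pi.
by apply: degle_ext IH => a; rewrite big_cons Pi.
Qed.

Lemma degleX d k u : degle d u -> degle (k * d) (fun a => u a ^+ k).
Proof.
move=> du; elim: k => [|k IH]; first exact: degle_cst.
rewrite mulSn; apply: degle_ext (degleM du IH) => a; by rewrite exprS.
Qed.

Definition lit := ('I_n * bool)%type.
Definition lval (a : cube n) (l : lit) : bool := a l.1 (+) l.2.

Lemma degle_lit l : degle 1 (fun a => (lval a l)%:R).
Proof.
have dX i : degle 1 (fun a : cube n => (a i)%:R).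
  by exists 'X_i; split=> [|a]; rewrite ?msizeX ?mdeg1 // /peval mevalXU.
case: l => i [] /=; last by apply: degle_ext (dX i) => a; rewrite /lval addbF.
apply: degle_ext (degleB (degle_cst 1 1) (dX i)) => a.
by rewrite /lval addbT /=; case: (a i); rewrite ?subrr ?subr0.
Qed.

Definition wt (a : cube n) (x : seq lit) : nat := count (lval a) x.

(** Pascal's rule along the list; unlike powers divided by factorials, binomials make sense in every
    characteristic. *)
Lemma degle_bin_count (T : Type) (val : T -> cube n -> bool) e (x : seq T) j :
  (forall t, degle e (fun a => (val t a)%:R)) ->
  degle (j * e) (fun a => 'C(count (val^~ a) x, j)%:R).
Proof.
move=> dval; elim: x j => [|l x IH] [|j].
- by apply: degle_ext (degle_cst 0 1) => a; rewrite bin0.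
- by apply: degle_ext (degle_cst _ 0) => a; rewrite bin0n.
- by apply: degle_ext (degle_cst 0 1) => a; rewrite bin0.
apply: degle_ext (degleD (IH j.+1) (degleM (dval l) (IH j))) => a /=.
case: (val l a); rewrite ?mul0r ?addr0 ?add0n //.
by rewrite add1n binS mul1r natrD.
Qed.

Lemma degle_bin x j : degle (j * 1) (fun a => 'C(wt a x, j)%:R).
Proof. exact/degle_bin_count/degle_lit. Qed.

(* [shbin s D t] continues ['C(t - s, D)] to the points [t < s] as a polynomial
   in t, so that it is an integral combination of the ['C(t, j)], [j <= D]. *)
Fixpoint shbin (s D t : nat) : F :=
  match s, D with
  | 0%N, _ => 'C(t, D)%:R
  | s'.+1, 0%N => 1
  | s'.+1, D'.+1 => (fix down D := if D is D'.+1 then shbin s' D t - down D' else 1) D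
  end.

Lemma shbinS s D t : shbin s.+1 D.+1 t = shbin s D.+1 t - shbin s.+1 D t.
Proof. by case: D. Qed.

Lemma shbinE s D t : (s <= t)%N -> shbin s D t = 'C(t - s, D)%:R.
Proof.
elim: s D => [|s IH] D st; first by rewrite subn0.
elim: D => [|D IHD]; first by rewrite bin0.
rewrite shbinS IHD IH 1?ltnW // subnS.
have : (0 < t - s)%N by rewrite subn_gt0.
by case: (t - s)%N => // r _; rewrite binS natrD addrK.
Qed.

Lemma degle_shbin s D e (N : cube n -> nat) :
  (forall j, degle (j * e) (fun a => 'C(N a, j)%:R)) ->
  degle (D * e) (fun a => shbin s D (N a)).
Proof.
move=> dN; elim: s D => [|s IH] D; first exact: dN.
elim: D => [|D IHD]; first exact: degle_cst.
have le : (D * e <= D.+1 * e)%N by rewrite leq_mul2r leqnSn orbT.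
by apply: degle_ext (degleB (IH D.+1) (degle_leq le IHD)) => a; rewrite shbinS.
Qed.

(** Newton interpolation: [shbin s D.+1] vanishes on [s, s + D] and is 1 at s + D + 1, so each new
    term corrects one new value. *)
Lemma interpolation s D (phi : nat -> F) :
  exists A : nat -> F,
    (forall e (N : cube n -> nat), (forall j, degle (j * e) (fun a => 'C(N a, j)%:R)) ->
       degle (D * e) (fun a => A (N a))) /\
    forall t, (s <= t <= s + D)%N -> A t = phi t.
Proof.
elim: D => [|D [A [dA eA]]].
  exists (fun=> phi s); split=> [e N _|t]; first exact: degle_cst.
  by rewrite addn0 => st; congr phi; lia.
pose c := phi (s + D.+1)%N - A (s + D.+1)%N.
exists (fun t => A t + c * shbin s D.+1 t); split=> [e N dN|t /andP[st tD]].
  apply: degleD; last exact/degleZ/degle_shbin.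
  by apply: degle_leq (dA e N dN); rewrite leq_mul2r leqnSn orbT.
rewrite shbinE //; have [tsD|] := leqP t (s + D).
  by rewrite eA ?st // bin_small ?mulr0 ?addr0 //; lia.
move=> ltt; have -> : t = (s + D.+1)%N by lia.
by rewrite addKn binn mulr1 /c addrC subrK.
Qed.

Lemma wt_interpolation s D (phi : nat -> F) :
  exists A : nat -> F, (forall x, degle D (fun a => A (wt a x))) /\
    forall t, (s <= t <= s + D)%N -> A t = phi t.
Proof.
have [A [dA eA]] := interpolation s D phi; exists A; split=> // x.
by rewrite -[D]muln1; apply/dA/degle_bin.
Qed.

End Degree.

(** * Finite random elements with bounded expected costs *)

Section Random.
Variable R : realType.

(* A finite random element of [S]; the expected value of [cost a] is at most
   [e a] for every [a].  Leaving the index [a] arbitrary lets one distribution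
   satisfy many bounds at once. *)
Definition rand (T : Type) (S : T -> Prop) (A : Type) (cost : A -> T -> R) (e : A -> R) :=
  exists (I : finType) (w : I -> R) (v : I -> T),
   [/\ forall i, 0 <= w i, \sum_i w i = 1, forall i, S (v i)
     & forall a, \sum_i w i * cost a (v i) <= e a].

Lemma rand_pure T (S : T -> Prop) A (cost : A -> T -> R) e t :
  S t -> (forall a, cost a t <= e a) -> rand S cost e.
Proof.
move=> St le; exists unit, (fun=> 1), (fun=> t); split=> //.
  by rewrite sumr_const card_unit mulr1n.
by move=> a; rewrite sumr_const card_unit mulr1n mul1r.
Qed.

(** Total expectation: the bound [e1 t] on the second stage is the cost of the first. *)
Lemma rand_bind T1 (S1 : T1 -> Prop) T (S : T -> Prop) A (cost : A -> T -> R)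
    (e1 : T1 -> A -> R) e :
  rand S1 (fun a t => e1 t a) e -> (forall t, S1 t -> rand S cost (e1 t)) ->
  rand S cost e.
Proof.
move=> [I [w [v [w0 w1 Sv le]]]] H.
have H' i : exists J : {J : finType & ((J -> R) * (J -> T))%type},
   [/\ forall j, 0 <= (projT2 J).1 j, \sum_j (projT2 J).1 j = 1,
     forall j, S ((projT2 J).2 j)
     & forall a, \sum_j (projT2 J).1 j * cost a ((projT2 J).2 j) <= e1 (v i) a].
  by have [J [w' [v' H']]] := H _ (Sv i); exists (existT _ J (w', v')).
have [J HJ] := choice H'.
exists {i : I & projT1 (J i)}, (fun p => w (tag p) * (projT2 (J (tag p))).1 (tagged p)),
  (fun p => (projT2 (J (tag p))).2 (tagged p)); split.
- by move=> [i j]; rewrite mulr_ge0 //; have [] := HJ i.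
- rewrite -(sig_big_dep xpredT (fun _ => xpredT) (fun i j => w i * (projT2 (J i)).1 j)) /= -w1.
  by apply: eq_bigr => i _; rewrite -mulr_sumr; have [_ -> _ _] := HJ i; rewrite mulr1.
- by move=> [i j]; have [] := HJ i.
move=> a; apply: le_trans (le a).
rewrite -(sig_big_dep xpredT (fun _ => xpredT)
  (fun i j => w i * (projT2 (J i)).1 j * cost a ((projT2 (J i)).2 j))) /=.
apply: ler_sum => i _; have [_ _ _ leJ] := HJ i.
under eq_bigr do rewrite -mulrA.
by rewrite -mulr_sumr ler_wpM2l.
Qed.

Lemma rand_map T (S : T -> Prop) A (cost : A -> T -> R) e T' (S' : T' -> Prop) A'
    (cost' : A' -> T' -> R) e' (f : T -> T') :
  rand S cost e -> (forall t, S t -> S' (f t)) ->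
  (forall a', exists a c b, [/\ 0 <= c, c * e a + b <= e' a'
     & forall t, S t -> cost' a' (f t) <= c * cost a t + b]) ->
  rand S' cost' e'.
Proof.
move=> [I [w [v [w0 w1 Sv le]]]] Sf H; exists I, w, (f \o v); split=> //= [i|a'].
  exact: Sf.
have [a [c [b [c0 leb leS]]]] := H a'; apply: le_trans leb.
apply: (@le_trans _ _ (\sum_i (c * (w i * cost a (v i)) + w i * b))).
  apply: ler_sum => i _; apply: le_trans (_ : w i * (c * cost a (v i) + b) <= _).
    by rewrite ler_wpM2l // leS.
  by rewrite mulrDr mulrCA.
by rewrite big_split /= -mulr_sumr -mulr_suml w1 mul1r lerD2r ler_wpM2l.
Qed.

End Random.

(** * Mixtures and a Chernoff estimate *)

Section Mix.
Variable R : realType.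

Lemma rand_mix T (S : T -> Prop) A (cost : A -> T -> R) e0 e1 e (q : R) :
  0 <= q <= 1 -> rand S cost e0 -> rand S cost e1 ->
  (forall a, (1 - q) * e0 a + q * e1 a <= e a) -> rand S cost e.
Proof.
move=> /andP[q0 q1] r0 r1 le.
apply: (@rand_bind _ bool (fun=> True) _ _ _ _ (fun b => if b then e1 else e0)).
  exists bool, (fun b : bool => if b then q else 1 - q), id; split=> [[]||//|a].
  - by [].
  - by rewrite subr_ge0.
  - by rewrite big_bool /= addrC subrK.
  - by rewrite big_bool /= addrC.
by case.
Qed.

Lemma expR_half_le (u : R) : 0 <= u <= 1 -> expR (u / 2) <= 1 + u.
Proof.
move=> /andP[u0 u1]; have h : 0 < 1 - u / 2 by lra.
rewrite -[X in expR X]opprK expRN -[X in _ <= X]invrK lef_pV2 ?posrE ?expR_gt0 //; last first.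
  by rewrite invr_gt0; lra.
apply: le_trans (expR_ge1Dx _).
have -> : (1 + u)^-1 = 1 - u + u ^+ 2 / (1 + u) by field; lra.
have : u ^+ 2 / (1 + u) <= u / 2 by rewrite ler_pdivrMr; nra.
by lra.
Qed.

(** The quotient is at most exp(u^2 t / 2 - u b / 2). For b = w this is at most e^(- u w / 4), and u
    w / 4 >= [lam]; raising b and t together by one does not increase it, since u <= 1/2. *)
Lemma chernoff_bound (w k t b : nat) (lam : R) (u := w%:R / (2 * (2 * k + w)%:R)) :
  (0 < w)%N -> 8 * lam * (2 * k + w)%:R <= w%:R ^+ 2 -> (w <= b)%N ->
  (t <= 2 * k + b)%N -> (1 + u ^+ 2 / 2) ^+ t / (1 + u) ^+ b <= expR (- lam).
Proof.
move=> w0 hlam wb tb; set N : R := (2 * k + w)%:R in u hlam *.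
have N0 : 0 < N by rewrite ltr0n; lia.
have wR : 0 < w%:R :> R by rewrite ltr0n.
have wN : w%:R <= N by rewrite ler_nat; lia.
have u0 : 0 <= u by apply: divr_ge0; lra.
have u1 : u <= 1 / 2 by rewrite /u ler_pdivrMr; lra.
have uN : u * N = w%:R / 2 by rewrite /u; field; lra.
have h1 : (1 + u ^+ 2 / 2) ^+ t <= expR (u ^+ 2 / 2 * t%:R).
  by rewrite expRM_natr lerXn2r ?nnegrE ?expR_ge0 ?expR_ge1Dx //; nra.
have h2 : expR (u / 2 * b%:R) <= (1 + u) ^+ b.
  rewrite expRM_natr lerXn2r ?nnegrE ?expR_ge0 //; first lra.
  by apply: expR_half_le; lra.
apply: (@le_trans _ _ (expR (u ^+ 2 / 2 * t%:R) / expR (u / 2 * b%:R))).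
  apply: ler_pM => //; first by rewrite exprn_ge0 //; nra.
    by rewrite invr_ge0 exprn_ge0 //; lra.
  by rewrite lef_pV2 ?posrE ?expR_gt0 ?exprn_gt0 //; lra.
rewrite -expRN -expRD ler_expR.
have tbR : t%:R <= N + (b%:R - w%:R) :> R.
  have -> : N + (b%:R - w%:R) = (2 * k + b)%:R by rewrite /N !natrD; ring.
  by rewrite ler_nat.
have wbR : w%:R <= b%:R :> R by rewrite ler_nat.
have e1 : u ^+ 2 * t%:R <= u ^+ 2 * (N + (b%:R - w%:R)) by rewrite ler_wpM2l ?sqr_ge0.
have e2 : u ^+ 2 * (b%:R - w%:R) <= u * (b%:R - w%:R) by rewrite ler_wpM2r; nra.
have e3 : u ^+ 2 * N = u * w%:R / 2 by rewrite expr2 -mulrA uN mulrA.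
have e4 : 4 * lam <= u * w%:R.
  by rewrite /u -[_ / _ * _]mulrAC ler_pdivlMr; nra.
by rewrite mulrDr in e1; nra.
Qed.

End Mix.

(** * Random halving of a list of literals, and counters *)

Section Counters.
Variables (R : realType) (F : fieldType) (n : nat).
Notation lit := (lit n).

(** A pair of true literals contributes exactly one, and [p <= ((1 + p) / 2) ^+ 2], so keeping one
    of each pair is no worse than independent sampling at rate 1/2. Indexing by [q] gives both tails
    for one distribution. *)
Lemma sample_law (x : seq lit) :
  rand (fun y : seq lit => (size y <= uphalf (size x))%N)
    (fun (aq : cube n * R) y => `|aq.2| ^+ wt aq.1 y)
    (fun aq => ((1 + `|aq.2|) / 2) ^+ wt aq.1 x).
Proof.
have half : 0 <= (1 / 2 : R) <= 1 by lra.
move: {2}(size x) (leqnn (size x)) => N; elim: N x => [|N IH] [|l1 [|l2 r]] // sx.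
- by apply: (@rand_pure _ _ _ _ _ _ [::]) => // a; rewrite !expr0.
- by apply: (@rand_pure _ _ _ _ _ _ [::]) => // a; rewrite !expr0.
- apply: (rand_mix half (e0 := fun=> 1) (e1 := fun aq => `|aq.2| ^+ lval aq.1 l1)).
  + by apply: (@rand_pure _ _ _ _ _ _ [::]).
  + by apply: (@rand_pure _ _ _ _ _ _ [:: l1]) => // a; rewrite /wt /= addn0.
  move=> [a q] /=; rewrite /wt /= addn0; have := normr_ge0 q.
  by case: (lval a l1); rewrite ?expr1 ?expr0; lra.
have {}IH : rand (fun y : seq lit => (size y <= uphalf (size r))%N)
    (fun (aq : cube n * R) y => `|aq.2| ^+ wt aq.1 y)
    (fun aq => ((1 + `|aq.2|) / 2) ^+ wt aq.1 r).
  by apply: IH; move: sx => /=; lia.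
have H l : rand (fun y : seq lit => (size y <= uphalf (size [:: l1, l2 & r]))%N)
    (fun (aq : cube n * R) y => `|aq.2| ^+ wt aq.1 y)
    (fun aq => `|aq.2| ^+ lval aq.1 l * ((1 + `|aq.2|) / 2) ^+ wt aq.1 r).
  apply: (rand_map (f := cons l) IH) => [y /=|[a q]]; first by lia.
  exists (a, q), (`|q| ^+ lval a l), 0; split=> //=; first exact: exprn_ge0.
    by rewrite addr0.
  by move=> y _; rewrite addr0 -exprD.
apply: (rand_mix half (H l1) (H l2)) => -[a q] /=; rewrite /wt /= -!/(wt _ _).
have := normr_ge0 q; set p := `|q| => p0.
have : 0 <= ((1 + p) / 2) ^+ wt a r by rewrite exprn_ge0; lra.
rewrite !exprD; set W := _ ^+ wt a r => W0.
have amgm : p * W <= (1 + p) / 2 * ((1 + p) / 2 * W).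
  by rewrite mulrA ler_wpM2r // -subr_ge0; have := sqr_ge0 (1 - p); nra.
by case: (lval a l1); case: (lval a l2); rewrite ?expr1 ?expr0 ?mul1r; lra.
Qed.

(** Each direction is restricted to the range where [counter_step] relies on it: small true weight,
    respectively small sampled weight. *)
Definition missampled (k w : nat) (x : seq lit) (a : cube n) (y : seq lit) : bool :=
  [&& wt a x < 2 * k & wt a x + w < 2 * wt a y]%N ||
  [&& wt a y < k & 2 * wt a y + w < wt a x]%N.

Lemma sample_tail (x : seq lit) (k w : nat) (lam : R) :
  (0 < w)%N -> 8 * lam * (2 * k + w)%:R <= w%:R ^+ 2 ->
  rand (fun y : seq lit => (size y <= uphalf (size x))%N)
    (fun a y => (missampled k w x a y)%:R) (fun=> 2 * expR (- lam)).
Proof.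
move=> w0 hlam; have [I [p [v [p0 p1 Sv law]]]] := sample_law x.
exists I, p, v; split=> // a.
set t := wt a x; pose u : R := w%:R / (2 * (2 * k + w)%:R); pose z := 1 + u.
have u0 : 0 <= u by apply: divr_ge0; rewrite ?mulr_ge0 ?ler0n.
have z1 : 1 <= z by rewrite /z; lra.
have z0 : 0 < z by lra.
(* An underestimate with j = [wt a y] < k has t - 2 j at least w and at least t - 2 k; the latter
   keeps the bound uniform in t. *)
pose b := maxn w (t - 2 * k).
pose U : R := if (t < 2 * k)%N then (z ^+ (t + w))^-1 else 0.
pose V := z ^+ t / z ^+ b.
have U0 : 0 <= U by rewrite /U; case: ifP => // _; rewrite invr_ge0 exprn_ge0 // ltW.
have V0 : 0 <= V by rewrite divr_ge0 // exprn_ge0 // ltW.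
(* Markov's inequality at [z ^+ 2] and [z ^- 2], one generating function for each tail. *)
have markov i : (missampled k w x a (v i))%:R
    <= U * `|z ^+ 2| ^+ wt a (v i) + V * `|z ^- 2| ^+ wt a (v i).
  rewrite !ger0_norm ?invr_ge0 ?exprn_ge0 ?(ltW z0) // exprVn -!exprM.
  set j := wt a (v i).
  have ge0 : 0 <= U * z ^+ (2 * j) + V / z ^+ (2 * j).
    by rewrite addr_ge0 ?mulr_ge0 ?invr_ge0 ?exprn_ge0 // ltW.
  rewrite /missampled -/t -/j.
  case: (boolP [&& _ & _]) => [/andP[tk tj]|_] /=.
    rewrite /U tk; apply: ler_wpDr; first by rewrite mulr_ge0 ?invr_ge0 ?exprn_ge0 // ltW.
    by rewrite ler_pdivlMl ?exprn_gt0 // mulr1 ler_weXn2l // ltnW.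
  case: (boolP [&& _ & _]) => [/andP[jk jt]|//].
  apply: ler_wpDl; first by rewrite mulr_ge0 ?exprn_ge0 // ltW.
  rewrite ler_pdivlMr ?exprn_gt0 // mul1r /V ler_pdivlMr ?exprn_gt0 // -exprD.
  by rewrite ler_weXn2l //; rewrite /b; lia.
apply: le_trans (ler_sum _ (fun i _ => ler_wpM2l (p0 i) (markov i))) _.
under eq_bigr do rewrite mulrDr [_ * (U * _)]mulrCA [_ * (V * _)]mulrCA.
rewrite big_split /= -!mulr_sumr.
have := ler_wpM2l U0 (law (a, z ^+ 2)); have := ler_wpM2l V0 (law (a, z ^- 2)).
rewrite /= -/t !ger0_norm ?invr_ge0 ?exprn_ge0 ?(ltW z0) //.
set c := 1 + u ^+ 2 / 2.
have c0 : 0 <= c by rewrite /c; nra.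
have cz1 : (1 + z ^+ 2) / 2 / z <= c.
  by rewrite ler_pdivrMr // /c /z; nra.
have cz2 : (1 + z ^- 2) / 2 * z <= c.
  have -> : (1 + z ^- 2) / 2 * z = (1 + z ^+ 2) / 2 / z by field; lra.
  exact: cz1.
have iz0 : 0 < z ^- 2 by rewrite invr_gt0 exprn_gt0.
have z20 : 0 < z ^+ 2 by rewrite exprn_gt0.
have tU : U * ((1 + z ^+ 2) / 2) ^+ t <= expR (- lam).
  rewrite /U; case: ifP => [tk|_]; last by rewrite mul0r expR_ge0.
  rewrite exprD invfM mulrAC -exprVn -exprMn.
  apply: le_trans (chernoff_bound w0 hlam (leqnn w) (leq_trans (ltnW tk) (leq_addr _ _))).
  rewrite -/u -/z ler_wpM2r ?invr_ge0 ?exprn_ge0 ?(ltW z0) //.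
  rewrite lerXn2r ?nnegrE //; first by rewrite mulr_ge0 ?invr_ge0 //; lra.
  by rewrite mulrC.
have tV : V * ((1 + z ^- 2) / 2) ^+ t <= expR (- lam).
  rewrite /V mulrAC -exprMn.
  have tb : (t <= 2 * k + b)%N by rewrite -leq_subLR leq_maxr.
  apply: le_trans (chernoff_bound w0 hlam (leq_maxl w (t - 2 * k)) tb).
  rewrite -/u -/z -/b ler_wpM2r ?invr_ge0 ?exprn_ge0 ?(ltW z0) //.
  rewrite lerXn2r ?nnegrE //; first by rewrite mulr_ge0 //; lra.
  by rewrite mulrC.
by lra.
Qed.

Definition miscounts (k : nat) (x : seq lit) (a : cube n) (E : nat -> cube n -> F) : bool :=
  ~~ all (fun j => E j a == (wt a x == j)%:R) (iota 0 k).

Lemma miscountsPn k x a E :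
  reflect (forall j, (j < k)%N -> E j a = (wt a x == j)%:R) (~~ miscounts k x a E).
Proof.
rewrite /miscounts negbK; apply: (iffP allP) => H j; last first.
  by rewrite mem_iota add0n => jk; rewrite H.
by move=> jk; apply/eqP/H; rewrite mem_iota.
Qed.

(** Quantifying over all lists of bounded size makes the property applicable to the random
    sample. *)
Definition counter (k m : nat) (eps : R) (d : nat) : Prop :=
  forall x : seq lit, (size x <= m)%N ->
    rand (fun E : nat -> cube n -> F => forall j, degle d (E j))
      (fun a E => (miscounts k x a E)%:R) (fun=> eps).

Lemma counter_weaken k k' m m' eps eps' d d' :
  (k <= k')%N -> (m <= m')%N -> eps' <= eps -> (d' <= d)%N ->
  counter k' m' eps' d' -> counter k m eps d.
Proof.
move=> kk mm ee dd H x sx; apply: (rand_map (f := id) (H x (leq_trans sx mm))).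
  by move=> E dE j; apply: degle_leq dd (dE j).
move=> a; exists a, 1, 0; split; rewrite ?mul1r ?addr0 //= => E _.
rewrite mul1r addr0 ler_nat.
case: (boolP (miscounts k' _ _ _)) => [_|/miscountsPn ok]; first exact: leq_b1.
by rewrite leqn0 eqb0; apply/miscountsPn => j jk; apply: ok; apply: leq_trans jk kk.
Qed.

Lemma counter_exact k m eps : 0 <= eps -> counter k m eps m.
Proof.
move=> eps0 x sx.
have /choice [A HA] : forall j, exists A : nat -> F,
    (forall x, degle m (fun a : cube n => A (wt a x))) /\
    forall t, (0 <= t <= 0 + m)%N -> A t = (t == j)%:R.
  by move=> j; apply: wt_interpolation.
apply: (@rand_pure _ _ _ _ _ _ (fun j a => A j (wt a x))) => [j|a].
  by have [] := HA j.
rewrite (_ : miscounts _ _ _ _ = false) //; apply/negbTE/miscountsPn => j _.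
have [_ -> //] := HA j; rewrite add0n; apply: leq_trans sx; exact: count_size.
Qed.

Lemma counter_step k k' m w (lam eps : R) d :
  (0 < w)%N -> (k + w <= 2 * k')%N -> 8 * lam * (2 * k' + w)%:R <= w%:R ^+ 2 ->
  counter k' (uphalf m) eps d -> counter k m (2 * expR (- lam) + eps) (d + 2 * w).
Proof.
move=> w0 kk hlam H x sx.
apply: (@rand_bind _ _ (fun y => (size y <= uphalf (size x))%N) _ _ _ _
  (fun y a => (missampled k' w x a y)%:R + eps)).
  apply: (rand_map (f := id) (sample_tail x w0 hlam)) => // a.
  by exists a, 1, eps; split=> // [|y _]; rewrite mul1r.
move=> y sy.
(* Truncation at 0 only moves the window to the right, so it still contains every t within w of 2
   i. *)
have /choice [A HA] : forall ij : nat * nat, exists A : nat -> F,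
    (forall x, degle (2 * w) (fun a : cube n => A (wt a x))) /\
    forall t, (2 * ij.1 - w <= t <= 2 * ij.1 - w + 2 * w)%N -> A t = (t == ij.2)%:R.
  by move=> ij; apply: wt_interpolation.
apply: (rand_map (f := fun (E : nat -> cube n -> F) j a =>
    \sum_(i < k') E i a * A (i : nat, j) (wt a x)) (H y (leq_trans sy (uphalf_leq sx)))).
  move=> E dE j; apply: degle_sum => i; apply: degleM => //.
  by have [dA _] := HA (i : nat, j); apply: dA.
move=> a; exists a, 1, (missampled k' w x a y)%:R; split=> //; first by rewrite mul1r addrC.
move=> E _; rewrite mul1r -natrD ler_nat.
case: (boolP (miscounts k' y a E)) => [_|/miscountsPn ok].
  by apply: leq_trans (leq_b1 _) _; rewrite add1n.
case: (boolP (missampled k' w x a y)) => [_|good]; first by rewrite leq_b1.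
rewrite leqn0 eqb0; apply/miscountsPn => j jk.
move: good; rewrite /missampled; set i := wt a y in ok *; set t := wt a x => good.
(* If i < k', only the i-th term survives and t lies in its window. Otherwise all terms vanish, and
   k + w <= 2 k' forces t >= k. *)
have [ik|ki] := ltnP i k'.
  rewrite (bigD1 (Ordinal ik)) //= ok // eqxx mul1r big1 ?addr0 => [|i' ii'].
    by have [_ -> //=] := HA (i, j); move: good; lia.
  rewrite ok //; case: eqP => [e|]; last by rewrite mul0r.
  by move/eqP: ii' => []; apply: val_inj.
rewrite big1 => [|i' _]; last first.
  by rewrite ok //; case: eqP => [e|]; rewrite ?mul0r //; have := ltn_ord i'; lia.
by have -> : (t == j) = false by apply/negbTE/eqP => tj; move: good; lia.
Qed.

End Counters.

(** * Iterated halving with shrinking thresholds *)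

Section Descent.
Variables (R : realType) (F : fieldType) (n : nat).

(** The sampling error has exponent 11 L and the recursive one L + 1/8; relative to e^(-L) they are
    at most 1/16 and 8/9. *)
Lemma halving_error (L : R) :
  1 / 2 <= L -> 2 * expR (- (11 * L)) + expR (- (L + 1 / 8)) <= expR (- L).
Proof.
move=> L2; rewrite (_ : - (11 * L) = - L + - (10 * L)); last by ring.
rewrite opprD !expRD; have := expR_gt0 (- L); set e := expR (- L) => e0.
have h1 : expR (- (10 * L)) <= 1 / 32.
  apply: le_trans (_ : expR (- 5) <= _); first by rewrite ler_expR; lra.
  rewrite expRN div1r lef_pV2 ?posrE ?expR_gt0 ?ltr0n // -[5]mulr1 expRM_natl.
  apply: le_trans (_ : 2 ^+ 5 <= _); first by rewrite -natrX ler_nat.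
  by rewrite lerXn2r ?nnegrE ?expR_ge0 ?ler0n //; have := expR_ge1Dx (1 : R); lra.
have h2 : expR (- (1 / 8)) <= 8 / 9 :> R.
  have -> : 8 / 9 = (9 / 8)^-1 :> R by field.
  rewrite expRN lef_pV2 ?posrE ?expR_gt0 //; last by lra.
  by have := expR_ge1Dx (1 / 8 : R); lra.
by nra.
Qed.

Lemma uphalf_bounds j : (j <= 2 * uphalf j <= j + 1)%N.
Proof. by lia. Qed.

Lemma le_of_sqr (x y : R) : 0 <= y -> x ^+ 2 <= y ^+ 2 -> x <= y.
Proof. by move=> y0 xy; case: (lerP x y) => // yx; nra. Qed.

(* Each step roughly halves k at the cost of a degree O(sqrt (k L)), so these
   degrees form a geometric series until k = O(L); the error e^(-L) is shared
   geometrically as well, by letting L grow by 1/8. *)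
Lemma descent (cond : nat -> nat -> Prop) (beta : R) :
  (forall k k' m, cond k m -> (k < 2 * k')%N -> cond k' (uphalf m)) ->
  1 <= beta ->
  (forall k m (L : R), 1 / 2 <= L -> k%:R <= 100 * (100 * L) -> cond k m ->
    exists d : nat, d%:R <= beta * L /\ counter F n k m (expR (- L)) d) ->
  forall k m (L : R), 1 / 2 <= L -> cond k m ->
    exists d : nat, d%:R <= 300 * beta * (Num.sqrt (k%:R * L) + L) /\
      counter F n k m (expR (- L)) d.
Proof.
move=> hcond beta1 base k; have [N] := ubnP k; elim: N k => [//|N IH] k kN m L L2 ckm.
(* Above this threshold s = sqrt (k L) satisfies 100 L <= s <= k / 100, so rounding and linear terms
   are small. *)
have [kL|kL] := lerP k%:R (100 * (100 * L)).
  have [d [dL cd]] := base _ _ _ L2 kL ckm; exists d; split=> //.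
  by have := mulr_ge0 (le_trans ler01 beta1) (sqrtr_ge0 (k%:R * L)); nra.
set s := Num.sqrt (k%:R * L).
have L0 : 0 < L by lra.
have k0 : 0 < k%:R :> R by nra.
have sE : s ^+ 2 = k%:R * L by rewrite sqr_sqrtr // mulr_ge0 // ltW.
have s0 : 0 <= s by apply: sqrtr_ge0.
have sL : 100 * L <= s.
  apply: le_of_sqr => //; rewrite sE.
  by have := ler_wpM2r (ltW L0) (ltW kL); lra.
have sk : 100 * s <= k%:R.
  apply: le_of_sqr; rewrite ?(ltW k0) // exprMn sE.
  by have := ler_wpM2l (ltW k0) (ltW kL); lra.
(* The factor 16 gives w^2 >= 256 s^2, enough for the Chernoff condition with [lam = 11 * L], whose
   main term is 88 L k = 88 s^2. *)
pose w := (Num.trunc (16 * s)).+1.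
have /truncn_itv : 0 <= 16 * s by lra.
rewrite -/w => /andP[w1 w2].
have {}w1 : w%:R <= 16 * s + 1 by rewrite /w -natr1; lra.
pose k' := uphalf (k + w).
have /andP[k'lo k'hi] := uphalf_bounds (k + w); rewrite -/k' in k'lo k'hi.
have kk' : (k < 2 * k')%N by apply: leq_trans k'lo; rewrite /w addnS ltnS leq_addr.
have k'1 : 2 * k'%:R <= k%:R + w%:R + 1 :> R.
  by rewrite -natrD -natrM natr1 ler_nat -[X in (_ <= X)%N]addn1.
have k'2 : k'%:R <= 3 / 5 * k%:R :> R by lra.
have k'N : (k' < N)%N.
  by rewrite -ltnS; apply: leq_trans kN; rewrite ltnS -(ltr_nat R); lra.
have [|d' [d'L cd']] := IH k' k'N (uphalf m) (L + 1 / 8) _ (hcond _ _ _ ckm kk').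
  by lra.
have ss : 50 * s <= s ^+ 2 by rewrite expr2 ler_wpM2r //; lra.
exists (d' + 2 * w)%N; split; last first.
  apply: (counter_weaken _ _ (halving_error L2) (leqnn _) (counter_step _ k'lo _ cd')) => //.
  have e1 : (2 * k' + w)%:R <= k%:R + 2 * w%:R + 1 :> R by rewrite natrD natrM; lra.
  have e2 : 256 * s ^+ 2 <= w%:R ^+ 2.
    have -> : 256 * s ^+ 2 = (16 * s) ^+ 2 by ring.
    by rewrite lerXn2r ?nnegrE ?ler0n //; lra.
  have e3 : L * w%:R <= s / 100 * (16 * s + 1) by apply: ler_pM => //; lra.
  have e4 := ler_wpM2l (ltW L0) e1.
  have e5 : s / 100 * (16 * s + 1) = 16 / 100 * s ^+ 2 + s / 100 by field.
  by rewrite !mulrDr [L * k%:R]mulrC -sE in e4; lra.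
set s' := Num.sqrt (k'%:R * (L + 1 / 8)) in d'L.
(* As k' <= 3/5 k and L + 1/8 <= 5/4 L, the square shrinks by 3/4 < (7/8)^2; the saved eighth of 300
   beta s pays for 2 w and for the growth of L. *)
have s's : s' <= 7 / 8 * s.
  apply: le_of_sqr; first by lra.
  rewrite /s' sqr_sqrtr; last by rewrite mulr_ge0 ?ler0n //; lra.
  have e : k'%:R * (L + 1 / 8) <= 3 / 5 * k%:R * (5 / 4 * L).
    by apply: ler_pM; rewrite ?ler0n //; lra.
  have e' : 3 / 5 * k%:R * (5 / 4 * L) = 3 / 4 * s ^+ 2 by rewrite sE; field.
  have e2 : (7 / 8 * s) ^+ 2 = 49 / 64 * s ^+ 2 by field.
  by have := sqr_ge0 s; lra.
rewrite natrD natrM.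
have b0 : 0 <= 300 * beta by lra.
have f1 := ler_wpM2l b0 s's.
have bs : s <= beta * s by rewrite ler_peMl.
have bs50 : beta * 50 <= beta * s by rewrite ler_wpM2l; lra.
by rewrite !mulrDr in d'L *; lra.
Qed.

End Descent.

(** * Stopping in any characteristic: halving down to one literal *)

Section CharZeroBase.
Variables (R : realType) (F : fieldType) (n : nat).

(** With w = k the threshold can stay at k, each level costs 2 k, and the Chernoff condition reads
    [24 * lam <= k]. After r levels at most one literal is left, which degree 1 handles exactly. *)
Lemma counter_levels k (lam : R) r m :
  (0 < k)%N -> 24 * lam <= k%:R -> (m <= 2 ^ r)%N ->
  counter F n k m (r%:R * (2 * expR (- lam))) (2 * k * r + 1).
Proof.
move=> k0 hk; elim: r m => [|r IH] m mr.
  rewrite mul0r muln0 expn0 in mr *.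
  exact: counter_weaken (leqnn k) mr (lexx 0) (leqnn 1) (@counter_exact R F n k 1 0 (lexx 0)).
have um : (uphalf m <= 2 ^ r)%N by rewrite leq_uphalf_double -mul2n -expnS.
have hlam : 8 * lam * (2 * k + k)%:R <= k%:R ^+ 2.
  have -> : 8 * lam * (2 * k + k)%:R = 24 * lam * k%:R by rewrite natrD natrM; ring.
  by rewrite expr2 ler_wpM2r ?ler0n.
have kk : (k + k <= 2 * k)%N by rewrite mul2n addnn.
apply: counter_weaken (counter_step k0 kk hlam (IH _ um)) => //.
  by rewrite -[r.+1]addn1 natrD; lra.
by rewrite mulnS; lia.
Qed.

Lemma base_by_halving (N : nat) (r : nat) : (0 < r)%N -> (N <= 2 ^ r)%N ->
  forall k m (L : R), 1 / 2 <= L -> k%:R <= 100 * (100 * L) -> (m <= N)%N ->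
  exists d : nat, d%:R <= 300 * (100 * r%:R ^+ 2) * L /\ counter F n k m (expR (- L)) d.
Proof.
move=> r0 Nr k m L L2 kL mN; have r1 : 1 <= r%:R :> R by rewrite ler1n.
(* The extra 2 r absorbs the union bound over r levels; [B] exceeds both the required k and 24
   [lam]. *)
pose lam := L + 2 * r%:R; pose B := 100 * (100 * L) + 24 * lam.
have B0 : 0 <= B by rewrite /B /lam; lra.
have /andP[k1 k2] := truncn_itv B0; set k' := (Num.trunc B).+1 in k2.
have k'B : k'%:R <= B + 1 by rewrite /k' -natr1; lra.
have hk : 24 * lam <= k'%:R by rewrite /B in k2; lra.
have kk' : (k <= k')%N by rewrite -(ler_nat R); rewrite /B /lam in k2; lra.
have cd := counter_levels (isT : (0 < k')%N) hk (leq_trans mN Nr).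
exists (2 * k' * r + 1)%N; split; last first.
  apply: counter_weaken cd => //.
  have h : 2 * r%:R * expR (- (2 * r%:R)) <= 1 :> R.
    rewrite expRN ler_pdivrMr ?expR_gt0 // mul1r.
    by have := expR_ge1Dx (2 * r%:R : R); lra.
  rewrite /lam opprD expRD; have := expR_ge0 (- L); set e := expR (- L) => e0.
  have -> : r%:R * (2 * (e * expR (- (2 * r%:R)))) = e * (2 * r%:R * expR (- (2 * r%:R))) by ring.
  by rewrite -[X in _ <= X]mulr1 ler_wpM2l.
have rL : L <= r%:R * L by rewrite ler_peMl //; lra.
have rrL : r%:R * L <= r%:R ^+ 2 * L by rewrite expr2 -mulrA ler_wpM2l //; lra.
have rr : r%:R ^+ 2 <= 2 * (r%:R ^+ 2 * L) by have := sqr_ge0 (r%:R : R); nra.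
have e : 2 * r%:R * k'%:R <= 2 * r%:R * (100 * (100 * L) + 24 * (L + 2 * r%:R) + 1).
  by rewrite ler_wpM2l //; lra.
by rewrite natrD !natrM; nra.
Qed.

End CharZeroBase.

(** * Sparse random sums of literals *)

Section SparseSum.
Variables (R : realType) (F : fieldType) (n : nat).

(** The mean of [phi] at a sum in F of w independent bits, each 1 with probability q. *)
Fixpoint sparse_mean (q : R) (phi : F -> R) (w : nat) : R :=
  if w is w'.+1 then
    (1 - q) * sparse_mean q phi w' + q * sparse_mean q (fun y => phi (1 + y)) w'
  else phi 0.

Definition natural_valued (u : cube n -> F) : Prop := forall a, exists m : nat, u a = m%:R.

(** Each literal is included with probability q. False literals add 0, so the law at a point depends
    on its weight alone; [phi] ranges over all tests of this law. *)
Lemma sparse_sum (q : R) (x : seq (lit n)) : 0 <= q <= 1 ->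
  rand (fun u : cube n -> F => degle 1 u /\ natural_valued u)
    (fun (ap : cube n * (F -> R)) u => ap.2 (u ap.1))
    (fun ap => sparse_mean q ap.2 (wt ap.1 x)).
Proof.
move=> q01; elim: x => [|l x IH].
  apply: (@rand_pure _ _ _ _ _ _ (fun=> 0)) => //.
  by split; [exact: degle_cst|move=> a; exists 0%N].
apply: (rand_mix (q := q) q01 IH (e1 := fun ap =>
    sparse_mean q (fun y => ap.2 ((lval ap.1 l)%:R + y)) (wt ap.1 x))).
  apply: (rand_map (f := fun u a => (lval a l)%:R + u a) IH) => [u [du nu]|[a phi]].
    split; first by apply: degleD => //; apply: degle_lit.
    by move=> a; have [m ->] := nu a; exists (lval a l + m)%N; rewrite natrD.
  exists (a, fun y => phi ((lval a l)%:R + y)), 1, 0; split=> //.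
    by rewrite mul1r addr0.
  by move=> u _; rewrite mul1r addr0.
move=> [a phi] /=; rewrite /wt /=; case: (lval a l) => //=.
rewrite add0n (_ : (fun y => phi (0 + y)) = phi); last by apply: funext => y; rewrite add0r.
by rewrite -mulrDl subrK mul1r.
Qed.

Lemma sparse_meanD q phi psi w :
  sparse_mean q (fun y => phi y + psi y) w = sparse_mean q phi w + sparse_mean q psi w.
Proof. by elim: w phi psi => //= w IH phi psi; rewrite !IH; ring. Qed.

Lemma sparse_mean_le q phi psi w : 0 <= q <= 1 -> (forall y, phi y <= psi y) ->
  sparse_mean q phi w <= sparse_mean q psi w.
Proof.
move=> /andP[q0 q1]; elim: w phi psi => //= w IH phi psi le.
by apply: lerD; apply: ler_wpM2l; rewrite ?subr_ge0 //; apply: IH.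
Qed.

Lemma sparse_mean_cst q c w : sparse_mean q (fun=> c) w = c.
Proof. by elim: w => //= w ->; ring. Qed.

(** The sum is 0 unless one of the w bits is 1; a union bound charges q to each. *)
Lemma sparse_mean_near0 q phi w : 0 <= q <= 1 -> (forall y, 0 <= phi y <= 1) ->
  sparse_mean q phi w <= phi 0 + w%:R * q.
Proof.
move=> q01; have /andP[q0 q1] := q01; elim: w phi => [|w IH] phi p01 /=.
  by rewrite mul0r addr0.
have i0 := IH _ p01.
have i1 : sparse_mean q (fun y => phi (1 + y)) w <= 1.
  rewrite -[X in _ <= X](sparse_mean_cst q 1 w); apply: sparse_mean_le => // y.
  by have /andP[] := p01 (1 + y).
have : 0 <= sparse_mean q phi w.
  rewrite -(sparse_mean_cst q 0 w); apply: sparse_mean_le => // y.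
  by have /andP[] := p01 y.
by rewrite -natr1; nra.
Qed.

(* The values v and v - 1 are distinct, so their probabilities add up to at
   most 1, which makes the excess over 1/2 decay geometrically. *)
Lemma sparse_mean_spread q v w : 0 <= q -> q <= 1 / 2 ->
  sparse_mean q (fun y => (y == v)%:R) w <= 1 / 2 + 1 / 2 * (1 - 2 * q) ^+ w.
Proof.
move=> q0 q1; elim: w => [|w IH] /=.
  by rewrite expr0; case: (0 == v) => /=; lra.
have h : sparse_mean q (fun y => (y == v)%:R) w
       + sparse_mean q (fun y => (1 + y == v)%:R) w <= 1.
  rewrite -sparse_meanD -[X in _ <= X](sparse_mean_cst q 1 w).
  apply: sparse_mean_le; first by lra.
  move=> y; case: (eqVneq y v) => [->|_]; last by rewrite add0r; case: (_ == _).
  rewrite -[X in _ == X]add0r (inj_eq (addIr v)) oner_eq0 /=; lra.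
by rewrite exprS; nra.
Qed.

End SparseSum.

(** * Stopping in positive characteristic: a vote separating small from large weights *)

Section GapThreshold.
Variables (R : realType) (F : fieldType) (n : nat).

Definition bit_of_degree (e : nat) :=
  {z : cube n -> bool | degle e (fun a => (z a)%:R : F)}.

(** By independence generating functions multiply. The base [B a] varies with the point, so that
    each weight range can test its own tail. *)
Lemma rand_copies e (B e1 : cube n -> R) r :
  (forall a, 0 <= B a) -> (forall a, 0 <= e1 a) ->
  rand (fun _ : bit_of_degree e => True) (fun a z => B a ^+ sval z a) e1 ->
  rand (fun zs : seq (bit_of_degree e) => (size zs <= r)%N)
    (fun a zs => B a ^+ count (fun z => sval z a) zs) (fun a => e1 a ^+ r).
Proof.
move=> B0 e10 r1; elim: r => [|r IH].
  by apply: (@rand_pure _ _ _ _ _ _ [::]) => // a; rewrite !expr0.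
apply: (@rand_bind _ _ (fun _ => True) _ _ _ _
  (fun (z : bit_of_degree e) a => B a ^+ sval z a * e1 a ^+ r)).
  apply: (rand_map (f := id) r1) => // a.
  exists a, (e1 a ^+ r), 0; split=> [|/=|z _]; rewrite ?exprn_ge0 // addr0.
    by rewrite exprSr.
  by rewrite mulrC.
move=> z _; apply: (rand_map (f := cons z) IH) => // a.
exists a, (B a ^+ sval z a), 0; split=> [|/=|zs _]; rewrite ?exprn_ge0 // addr0 //.
by rewrite /= exprD.
Qed.

Variable p : nat.
Hypothesis charFp : p \in [pchar F].

(** Fermat's little theorem makes the test for nonzero a polynomial of degree p - 1. *)
Lemma natr_expp_pred m : (m%:R : F) ^+ p.-1 = (m%:R != 0 :> F)%:R.
Proof.
have p0 : (0 < p)%N by apply: prime_gt0; case/andP: charFp.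
have fix_m : (m%:R : F) ^+ p = m%:R.
  by have := pFrobenius_aut_nat charFp m; rewrite pFrobenius_autE.
case: eqP => [-> | /eqP m0] /=.
  rewrite expr0n; have : (1 < p)%N by apply: prime_gt1; case/andP: charFp.
  by case: p => [|[]].
by apply: (mulfI m0); rewrite -exprS prednK // mulr1 fix_m.
Qed.

(** The sum is nonzero with probability S, where S <= 1/64 below weight k, and S >= 3/8 from 64 k on
    because (1 - 2 q)^t <= e^(-2) there. The mean is 1 + (B - 1) S, so the bases 16 and 1/2 give 5/4
    and 13/16. *)
Lemma sparse_bit (x : seq (lit n)) (k : nat) (q : R) (B : cube n -> R) :
  (0 < k)%N -> q = (64 * k%:R)^-1 ->
  (forall a, B a = if (wt a x < k)%N then 16 else 1 / 2) ->
  rand (fun _ : bit_of_degree p.-1 => True) (fun a z => B a ^+ sval z a)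
    (fun a => if (wt a x < k)%N then 5 / 4 else
              if (64 * k <= wt a x)%N then 13 / 16 else 1).
Proof.
move=> k0 qE BE; have kR : 1 <= k%:R :> R by rewrite ler1n.
have q0 : 0 < q by rewrite qE invr_gt0; lra.
have qk : q * k%:R = 1 / 64 by rewrite qE; field; lra.
have q64 : q <= 1 / 64 by rewrite -qk ler_peMr // ltW.
have q01 : 0 <= q <= 1 by lra.
have [I [w [v [w0 w1 Sv le]]]] := sparse_sum F x q01.
have dz i : degle p.-1 (fun a => (v i a != 0)%:R : F).
  have [dv nv] := Sv i; rewrite -[p.-1]muln1; apply: degle_ext (degleX p.-1 dv) => a.
  by have [m ->] := nv a; rewrite natr_expp_pred.
exists I, w, (fun i => exist _ (fun a => v i a != 0) (dz i)); split=> // a /=.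
set t := wt a x in BE *.
pose S := \sum_i w i * (v i a != 0)%:R.
have SB : \sum_i w i * B a ^+ (v i a != 0) = 1 + (B a - 1) * S.
  rewrite -[X in X + _]w1 mulr_sumr -big_split /=; apply: eq_bigr => i _.
  by case: (_ != 0) => /=; rewrite ?expr1 ?expr0; ring.
have S0 : 0 <= S by apply: sumr_ge0 => i _; rewrite mulr_ge0 ?ler0n.
have Sle : S <= t%:R * q.
  apply: le_trans (le (a, fun y => (y != 0)%:R)) _ => /=.
  rewrite -/t -[X in _ <= X]add0r -[X in X + _](_ : (0 != 0 :> F)%:R = 0); last by rewrite eqxx.
  apply: (@sparse_mean_near0 _ _ q (fun y => (y != 0)%:R)) => // y.
  by case: (y != 0); rewrite /= ?lexx ler01.
have Sge : 1 - S <= 1 / 2 + 1 / 2 * (1 - 2 * q) ^+ t.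
  have -> : 1 - S = \sum_i w i * (v i a == 0)%:R.
    rewrite -[X in X - _]w1 -sumrB; apply: eq_bigr => i _.
    by case: (v i a == 0) => /=; ring.
  apply: le_trans (le (a, fun y => (y == 0)%:R)) _ => /=.
  by apply: sparse_mean_spread; lra.
rewrite SB (BE a); case: ifP => [tk|_].
  have : t%:R * q <= 1 / 64.
    by rewrite -qk mulrC; apply: ler_wpM2l; [exact: ltW|rewrite ler_nat ltnW].
  by lra.
case: ifP => [kt|_]; last by lra.
have tq : 1 <= q * t%:R.
  have : (64 * k)%:R <= t%:R :> R by rewrite ler_nat.
  rewrite natrM => h; have := ler_wpM2l (ltW q0) h; rewrite mulrCA qk; lra.
suff : (1 - 2 * q) ^+ t <= 1 / 4 by lra.
apply: (@le_trans _ _ (expR (- 2 * q * t%:R))).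
  rewrite expRM_natr lerXn2r ?nnegrE ?expR_ge0 //; first by lra.
  by have := expR_ge1Dx (- 2 * q); lra.
apply: (@le_trans _ _ (expR (- 2))); first by rewrite ler_expR; lra.
rewrite expRN div1r lef_pV2 ?posrE ?expR_gt0 ?ltr0n // -[X in expR X]mulr1 expRM_natl.
have -> : 4 = 2 ^+ 2 :> R by ring.
by rewrite lerXn2r ?nnegrE ?expR_ge0 ?ler0n //; have := expR_ge1Dx (1 : R); lra.
Qed.

(* The majority-style vote over 8s sparse sums, each nonzero with probability
   at most 1/64 below weight k and at least 3/8 from weight 64 k on. *)
Lemma gap_threshold (x : seq (lit n)) (k s : nat) : (0 < k)%N ->
  rand (fun T : cube n -> F => degle (8 * s * p.-1) T)
    (fun a T => ((wt a x < k)%N && (T a != 1) || (64 * k <= wt a x)%N && (T a != 0))%:R)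
    (fun=> (1 / 2 : R) ^+ s).
Proof.
move=> k0; pose B a : R := if (wt a x < k)%N then 16 else 1 / 2.
have B0 a : 0 < B a by rewrite /B; case: ifP => _; lra.
have r1 := @sparse_bit x k _ B k0 erefl (fun a => erefl).
have e10 a : 0 <= (if (wt a x < k)%N then 5 / 4 else
              if (64 * k <= wt a x)%N then 13 / 16 else 1) :> R.
  by case: ifP => _; [lra|case: ifP => _; lra].
have [A [dA eA]] := interpolation n 0 (8 * s) (fun t => (t < s)%N%:R : F).
apply: (rand_map (f := fun (zs : seq (bit_of_degree p.-1)) a => A (count (fun z => sval z a) zs))
  (rand_copies (8 * s) (fun a => ltW (B0 a)) e10 r1)).
  by move=> zs _; apply: dA => j; apply: degle_bin_count => z; apply: (svalP z).
(* Markov's inequality divides the moment by B^s; both (5/4)^8 / 16 and 2 (13/16)^8 are at most 1/2,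
   which explains 8 s votes with threshold s. *)
move=> a; have Bs : 0 <= (B a ^+ s)^-1 by rewrite invr_ge0 exprn_ge0 ?ltW.
have [tk|kt] := ltnP (wt a x) k.
  exists a, ((B a ^+ s)^-1), 0; rewrite tk; split=> // [|zs szs].
    rewrite /B tk addr0 mulrC -exprVn exprM -exprMn lerXn2r ?nnegrE //; lra.
  have kk : (64 * k <= wt a x)%N = false.
    by apply/negbTE; rewrite -ltnNge; apply: leq_trans tk _; rewrite leq_pmull.
  rewrite kk /= orbF addr0.
  rewrite eA ?add0n ?(leq_trans (count_size _ _)) //.
  have [_|sN] := ltnP; first by rewrite eqxx mulr_ge0 // exprn_ge0 // ltW.
  apply: le_trans (_ : 1 <= _); first by case: (_ != 1).
  by rewrite ler_pdivlMl ?exprn_gt0 // mulr1 ler_weXn2l // /B tk; lra.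
rewrite /=; have [kw|wk] := leqP (64 * k) (wt a x); last first.
  exists a, 0, 0; split=> //; first by rewrite mul0r addr0 exprn_ge0 //; lra.
  by move=> zs _; rewrite /= mul0r addr0.
exists a, ((B a ^+ s)^-1), 0; split=> // [|zs szs].
  rewrite ltnNge kt kw /= /B ltnNge kt /= addr0 mulrC -exprVn exprM -exprMn lerXn2r ?nnegrE //; lra.
rewrite /= addr0 eA ?add0n ?(leq_trans (count_size _ _)) //.
have [Ns|_] := ltnP; last by rewrite eqxx mulr_ge0 // exprn_ge0 // ltW.
apply: le_trans (_ : 1 <= _); first by case: (_ != 0).
rewrite ler_pdivlMl ?exprn_gt0 // mulr1 /B ltnNge kt /= ler_wiXn2l //; [lra|lra|exact: ltnW].
Qed.

Lemma base_prime_char k m (L : R) : 1 / 2 <= L -> k%:R <= 100 * (100 * L) ->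
  exists d : nat, d%:R <= (100 * (100 * 100) + 32 * p%:R) * L /\ counter F n k m (expR (- L)) d.
Proof.
move=> L2 kL; have L0 : 0 <= 2 * L by lra.
(* As e^(1/2) <= 2, having s > 2 L gives 2^(-s) <= e^(-L). *)
have /andP[s1 s2] := truncn_itv L0; set s := (Num.trunc _).+1 in s2.
have {}s1 : s%:R <= 2 * L + 1 by rewrite /s -natr1; lra.
exists (64 * k.+1 + 8 * s * p.-1)%N; split.
  have pp : p.-1%:R <= p%:R :> R by rewrite ler_nat leq_pred.
  have e : s%:R * p.-1%:R <= 4 * L * p%:R by apply: ler_pM => //; lra.
  by rewrite natrD !natrM -natr1; lra.
move=> x sx.
have /choice [A HA] : forall j, exists A : nat -> F,
    (forall x, degle (64 * k.+1) (fun a : cube n => A (wt a x))) /\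
    forall t, (0 <= t <= 0 + 64 * k.+1)%N -> A t = (t == j)%:R.
  by move=> j; apply: wt_interpolation.
apply: (rand_map (f := fun T j a => A j (wt a x) * T a) (gap_threshold x s (ltn0Sn k))).
  by move=> T dT j; apply: degleM => //; have [dA _] := HA j.
move=> a; exists a, 1, 0; split=> //; rewrite ?mul1r ?addr0.
  rewrite exprVn expRN lef_pV2 ?posrE ?expR_gt0 ?exprn_gt0 //.
  have e2 : expR (1 / 2) <= 2 :> R.
    have := expR_half_le (_ : 0 <= (1 : R) <= 1); rewrite -natr1; apply.
    by rewrite ler01 lexx.
  apply: (@le_trans _ _ (expR (1 / 2 * s%:R))); first by rewrite ler_expR; lra.
  by rewrite expRM_natr lerXn2r ?nnegrE ?expR_ge0 ?ler0n.
move=> T dT; rewrite mul1r addr0 ler_nat.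
case: (boolP (_ || _)) => [_|]; first exact: leq_b1.
rewrite negb_or !negb_and !negbK => /andP[Tsmall Tlarge].
rewrite leqn0 eqb0; apply/miscountsPn => j jk.
(* The vote is 1 below k + 1 and 0 beyond 64 (k + 1); in between its value is irrelevant, as the
   interpolant of [t = j] with j < k is 0 there. *)
have [wK|Kw] := leqP (wt a x) (64 * k.+1).
  have [_ ->] := HA j; last by rewrite add0n.
  case: eqP => [tj|_]; last by rewrite mul0r.
  move: Tsmall; rewrite tj ltnS ltnW //= => /eqP ->; exact: mulr1.
move: Tlarge; rewrite (ltnW Kw) => /eqP ->; rewrite mulr0.
by have -> : (wt a x == j) = false by apply/negbTE/eqP => tj; move: Kw jk; rewrite tj; lia.
Qed.

End GapThreshold.

(** * From random functions and counters to probabilistic degree *)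

Section FromRandom.
Variables (R : realType) (F : fieldType) (n : nat).
Implicit Types (f g h : boolfun n).

Definition approximates (eps : R) f (d : nat) : Prop :=
  rand (@degle F n d) (fun a u => (u a != (f a)%:R)%:R) (fun=> eps).

Lemma approximates_prob_poly eps f d : approximates eps f d -> has_prob_poly F eps f d.
Proof.
move=> [I [w [v [w0 w1 Sv err]]]]; have [Q HQ] := choice Sv.
pose S := [fset Q i | i in I]%fset.
pose D : {fsfun {mpoly F[n]} -> R with 0} := [fsfun q in S => \sum_(i | Q i == q) w i | 0].
have DE q : D q = \sum_(i | Q i == q) w i.
  rewrite fsfunE; case: ifPn => // qS; rewrite big1 // => i /eqP Qi.
  by case/negP: qS; apply/imfsetP; exists i.
have D0 q : 0 <= D q by rewrite DE sumr_ge0.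
have sumD (P : pred {mpoly F[n]}) : \sum_(q <- finsupp D | P q) D q = \sum_(i | P (Q i)) w i.
  under eq_bigr do rewrite DE.
  rewrite (exchange_big_dep xpredT) //= [RHS]big_mkcond; apply: eq_bigr => i _.
  have [Qi|Qi] := boolP (Q i \in finsupp D).
    rewrite big_mkcond (bigD1_seq (Q i)) ?fset_uniq //= eqxx andbT big1 ?addr0 // => q qQ.
    by rewrite eq_sym (negPf qQ) andbF.
  have -> : w i = 0.
    apply/le_anti; rewrite w0 andbT.
    have <- : D (Q i) = 0 by apply/eqP; rewrite memNfinsupp in Qi.
    by rewrite DE (bigD1 i) //= lerDl sumr_ge0.
  by rewrite big1_eq; case: ifP.
have D1 : \sum_(q <- finsupp D) D q = 1 by rewrite sumD.
exists (ProbPoly D0 D1); split=> [q|a].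
  rewrite mem_finsupp /= DE => /eqP nz.
  have [i /eqP <-|none] := pickP (fun i => Q i == q); first by have [] := HQ i.
  by case: nz; rewrite big_pred0.
rewrite /error_at /= sumD; apply: le_trans (err a); rewrite big_mkcond /=.
apply: ler_sum => i _; have [_ ->] := HQ i.
by case: (_ != _); rewrite ?mulr1 ?mulr0.
Qed.

Lemma pdeg_approximates eps f d : 0 <= eps -> approximates eps f d -> (pdeg F eps f <= d)%N.
Proof. by move=> eps0 /approximates_prob_poly; have [_] := @pdegP R F n eps f eps0; apply. Qed.

Lemma approximates_weaken eps eps' f d d' :
  eps <= eps' -> (d <= d')%N -> approximates eps f d -> approximates eps' f d'.
Proof.
move=> ee dd H; apply: (rand_map (f := id) H) => [u|a]; first exact: degle_leq.
by exists a, 1, 0; split=> [//||u _]; rewrite mul1r addr0.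
Qed.

Lemma approximates_exact eps f d :
  0 <= eps -> degle d (fun a => (f a)%:R : F) -> approximates eps f d.
Proof.
by move=> eps0 df; apply: (rand_pure df) => a; rewrite eqxx.
Qed.

(** A fair coin between the constants 0 and 1 errs with probability 1/2 at every point. *)
Lemma approximates_coin eps f : 1 / 2 <= eps -> approximates eps f 0.
Proof.
move=> eps2; have half : 0 <= (1 / 2 : R) <= 1 by lra.
apply: (rand_mix half (e0 := fun a => (0 != (f a)%:R :> F)%:R)
  (e1 := fun a => (1 != (f a)%:R :> F)%:R)).
- by apply: (@rand_pure _ _ _ _ _ _ (fun=> 0)) => //; apply: degle_cst.
- by apply: (@rand_pure _ _ _ _ _ _ (fun=> 1)) => //; apply: degle_cst.
move=> a; case: (f a) => /=; rewrite eqxx ?[0 == 1]eq_sym oner_eq0 /=; lra.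
Qed.

Lemma approximates_xor eps f g h d e :
  (forall a, f a = g a (+) h a) -> degle e (fun a => (g a)%:R : F) ->
  approximates eps h d -> approximates eps f (e + d).
Proof.
move=> fE dg H.
apply: (rand_map (f := fun u a => (g a)%:R + u a - 2 * ((g a)%:R * u a)) H) => [u du|a].
  apply: degleB; last exact/degleZ/degleM.
  apply: degleD; first by apply: degle_leq dg; apply: leq_addr.
  by apply: degle_leq du; apply: leq_addl.
exists a, 1, 0; split=> [//||u _]; rewrite mul1r addr0 // ler_nat.
case: (eqVneq (u a) (h a)%:R) => [->|_]; last exact: leq_b1.
rewrite (fE a) leqn0 eqb0 negbK; apply/eqP.
by case: (g a); case: (h a) => /=; ring.
Qed.

Definition pos_lits : seq (lit n) := [seq (i, false) | i <- enum 'I_n].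
Definition neg_lits : seq (lit n) := [seq (i, true) | i <- enum 'I_n].

Lemma wt_pos (a : cube n) : wt a pos_lits = weight a.
Proof.
rewrite /wt /weight count_map -sum1_card -sum1_count big_enum_cond /=.
by apply: eq_bigl => i; rewrite inE /lval addbF.
Qed.

Lemma wt_neg (a : cube n) : wt a neg_lits = (n - weight a)%N.
Proof.
have := count_predC (preim (fun i => (i, false)) (lval a)) (enum 'I_n).
rewrite size_enum_ord -count_map -/(wt a pos_lits) wt_pos => nE.
rewrite -[X in (X - _)%N]nE addKn /wt count_map.
by apply: eq_count => i; rewrite /= /lval addbF addbT.
Qed.

Lemma weight_le (a : cube n) : (weight a <= n)%N.
Proof. by rewrite -[X in (_ <= X)%N](card_ord n) max_card. Qed.

Lemma approximates_symmetric eps f d :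
  symmetric_fun f -> counter F n n.+1 n eps d -> approximates eps f d.
Proof.
move=> symf H; have sz : (size pos_lits <= n)%N by rewrite size_map size_enum_ord.
apply: (rand_map (f := fun E a => \sum_(j < n.+1) (Spec f j)%:R * E (j : nat) a) (H _ sz)).
  by move=> E dE; apply: degle_sum => j; apply: degleZ.
move=> a; exists a, 1, 0; split=> [//||E _]; rewrite mul1r addr0 // ler_nat.
case: (boolP (miscounts _ _ _ _)) => [_|/miscountsPn ok]; first exact: leq_b1.
rewrite leqn0 eqb0 negbK; apply/eqP.
have wn : (weight a < n.+1)%N by rewrite ltnS weight_le.
rewrite (bigD1 (Ordinal wn)) //= ok // wt_pos eqxx mulr1 -SpecE // big1 ?addr0 //.
move=> j nj; rewrite ok // wt_pos; case: eqP => [e|]; last by rewrite mulr0.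
by case/eqP: nj; apply: val_inj.
Qed.

Lemma boundedP f k i j : bounded f k -> (k <= i <= n - k)%N -> (k <= j <= n - k)%N ->
  Spec f i = Spec f j.
Proof.
move=> bf hi hj; have lt t : (k <= t <= n - k)%N -> (t < n.+1)%N by lia.
move/forallP: bf => /(_ (Ordinal (lt _ hi)))/forallP/(_ (Ordinal (lt _ hj))) /=.
by rewrite hi hj => /eqP.
Qed.

(** Start from the middle value c and correct it near both ends, with one counter for ones and one
    for zeros; a union bound gives 2 eps. As 2 k <= n, the corrections never overlap. *)
Lemma approximates_bounded eps f k d :
  symmetric_fun f -> bounded f k -> (2 * k <= n)%N -> counter F n k n eps d ->
  approximates (2 * eps) f d.
Proof.
move=> symf bf kn H; pose c : F := (Spec f k)%:R.
have szp : (size pos_lits <= n)%N by rewrite size_map size_enum_ord.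
have szn : (size neg_lits <= n)%N by rewrite size_map size_enum_ord.
apply: (@rand_bind _ _ (fun E : nat -> cube n -> F => forall j, degle d (E j)) _ _ _ _
  (fun E a => (miscounts k pos_lits a E)%:R + eps)).
  apply: (rand_map (f := id) (H _ szp)) => // a.
  by exists a, 1, eps; split=> [//||E _]; rewrite mul1r //; lra.
move=> E dE; apply: (rand_map (f := fun E' a => c +
   (\sum_(j < k) ((Spec f j)%:R - c) * E (j : nat) a +
    \sum_(j < k) ((Spec f (n - j))%:R - c) * E' (j : nat) a)) (H _ szn)).
  move=> E' dE'; apply: degleD; first exact: degle_cst.
  by apply: degleD; apply: degle_sum => j; apply: degleZ.
move=> a; exists a, 1, (miscounts k pos_lits a E)%:R; split=> [//||E' _].
  by rewrite mul1r addrC.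
rewrite mul1r -natrD ler_nat.
case: (boolP (miscounts k neg_lits a E')) => [_|/miscountsPn ok'].
  by apply: leq_trans (leq_b1 _) _; rewrite add1n.
case: (boolP (miscounts k pos_lits a E)) => [_|/miscountsPn ok]; first by rewrite leq_b1.
rewrite leqn0 eqb0 negbK; apply/eqP; rewrite (SpecE _ symf).
have := weight_le a; set t := weight a => tn.
have sum1 : \sum_(j < k) ((Spec f j)%:R - c) * E (j : nat) a =
    if (t < k)%N then (Spec f t)%:R - c else 0.
  case: ltnP => tk.
    rewrite (bigD1 (Ordinal tk)) //= ok // wt_pos eqxx mulr1 big1 ?addr0 //.
    move=> j nj; rewrite ok // wt_pos; case: eqP => [e|]; last by rewrite mulr0.
    by case/eqP: nj; apply: val_inj.
  rewrite big1 // => j _; rewrite ok // wt_pos -/t.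
  by rewrite gtn_eqF ?mulr0 // (leq_trans (ltn_ord j) tk).
have sum2 : \sum_(j < k) ((Spec f (n - j))%:R - c) * E' (j : nat) a =
    if (n - t < k)%N then (Spec f t)%:R - c else 0.
  case: ltnP => tk.
    rewrite (bigD1 (Ordinal tk)) //= ok' // wt_neg eqxx mulr1 big1 ?addr0 ?subKn //.
    move=> j nj; rewrite ok' // wt_neg; case: eqP => [e|]; last by rewrite mulr0.
    by case/eqP: nj; apply: val_inj.
  rewrite big1 // => j _; rewrite ok' // wt_neg -/t.
  by rewrite gtn_eqF ?mulr0 // (leq_trans (ltn_ord j) tk).
rewrite sum1 sum2; case: ltnP => tk; case: ltnP => ntk.
- by move: tk ntk kn tn; clear; lia.
- by rewrite addr0 addrC subrK.
- by rewrite add0r addrC subrK.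
rewrite !addr0 /c; congr (nat_of_bool _)%:R.
by apply: (@boundedP f k) => //; move: tk ntk kn tn; clear; lia.
Qed.

End FromRandom.

(** * Exact polynomials for periods that are powers of the characteristic *)

Section Periodic.
Variables (F : fieldType) (p : nat).
Hypothesis charFp : p \in [pchar F].

(** With q = p^k, i C(q, i) = q C(q - 1, i - 1); if p did not divide C(q, i), then q would divide
    i. *)
Lemma bin_pchar_pow k i : (0 < i < p ^ k)%N -> 'C(p ^ k, i)%:R = 0 :> F.
Proof.
case: i => // i /andP[_ ik]; have pp : prime p by case/andP: charFp.
have q0 : (0 < p ^ k)%N by rewrite expn_gt0 prime_gt0.
apply/eqP; rewrite -(dvdn_pcharf charFp); apply: contraTT ik => ndvd; rewrite -leqNgt.
have : (p ^ k %| i.+1 * 'C(p ^ k, i.+1))%N by rewrite -mul_bin_diag dvdn_mulr.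
rewrite Gauss_dvdl; last by rewrite coprimeXl // prime_coprime.
by move/dvdn_leq; apply.
Qed.

(** In Vandermonde's sum only the term choosing nothing from p^k survives modulo p. *)
Lemma bin_periodic k t j : (j < p ^ k)%N -> 'C(t + p ^ k, j)%:R = 'C(t, j)%:R :> F.
Proof.
move=> jk; rewrite addnC -binomial.Vandermonde natr_sum big_ord_recl /=.
rewrite bin0 mul1n subn0 big1 ?addr0 // => i _; rewrite natrM bin_pchar_pow ?mul0r //.
by rewrite /bump /= add1n (leq_ltn_trans (ltn_ord i) jk).
Qed.

Lemma newton_coefficients D (phi : nat -> F) :
  exists c : nat -> F, forall t, (t <= D)%N -> \sum_(j < D.+1) c j * 'C(t, j)%:R = phi t.
Proof.
elim: D => [|D [c cE]].
  by exists (fun=> phi 0%N) => t; rewrite leqn0 big_ord1 => /eqP ->; rewrite bin0 mulr1.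
pose c' := fun j => if j == D.+1 then phi D.+1 - \sum_(i < D.+1) c i * 'C(D.+1, i)%:R else c j.
have c'E t : \sum_(j < D.+1) c' j * 'C(t, j)%:R = \sum_(j < D.+1) c j * 'C(t, j)%:R.
  by apply: eq_bigr => j _; rewrite /c' ltn_eqF.
exists c' => t; rewrite leq_eqVlt big_ord_recr /= c'E /c' eqxx => /orP[/eqP ->|tD].
  by rewrite binn mulr1 addrC subrK.
by rewrite cE // bin_small // mulr0 addr0.
Qed.

(** Interpolate the spectrum on one period by the C(t, j) with j < q; these are q-periodic too, so
    agreement extends to [0, n]. *)
Lemma degle_periodic n (g : boolfun n) k :
  symmetric_fun g -> is_period g (p ^ k) -> degle (p ^ k) (fun a => (g a)%:R : F).
Proof.
move=> symg /andP[q0 /forallP per_g]; set q := (p ^ k)%N in q0 per_g *.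
have [c cE] := newton_coefficients q.-1 (fun t => (Spec g t)%:R).
rewrite prednK // in cE.
have {}cE t : (t <= n)%N -> \sum_(j < q) c j * 'C(t, j)%:R = (Spec g t)%:R.
  have [N] := ubnP t; elim: N t => // N IH t tN tn.
  have [tq|qt] := ltnP t q; first by apply: cE; rewrite -ltnS prednK.
  have lt : (t - q < n.+1)%N by apply: leq_ltn_trans (leq_subr _ _) _.
  have := per_g (Ordinal lt); rewrite /= subnK // tn => /eqP <-.
  rewrite -IH; [|by lia|by lia].
  by apply: eq_bigr => j _; rewrite -{1}(subnK qt) bin_periodic.
apply: degle_ext (_ : degle q (fun a => \sum_(j < q) c j * 'C(wt a (pos_lits n), j)%:R)).
  by move=> a; rewrite wt_pos cE ?weight_le // -SpecE.
apply: degle_sum => j; apply: degleZ; apply: degle_leq (degle_bin F _ j).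
by rewrite muln1 ltnW.
Qed.

End Periodic.

(** * Constant, periodic and bounded spectra *)

Lemma degle_constant (F : fieldType) n (g : boolfun n) : symmetric_fun g ->
  (forall i, (i <= n)%N -> Spec g i = Spec g 0) -> degle 0 (fun a => (g a)%:R : F).
Proof.
move=> symg cst; apply: degle_ext (degle_cst n 0 (Spec g 0)%:R) => a.
by rewrite (SpecE a symg) cst // weight_le.
Qed.

Lemma per_is_period n (g : boolfun n) : is_period g (per g).
Proof. by rewrite /per; case: ex_minnP. Qed.

Lemma bounded_Bd n (h : boolfun n) : bounded h (Bd h).
Proof. by rewrite /Bd; case: ex_minnP. Qed.

Lemma period1_constant n (g : boolfun n) i : is_period g 1 -> (i <= n)%N -> Spec g i = Spec g 0.
Proof.
move=> /forallP H; elim: i => // i IH ltin; rewrite -IH ?(ltnW ltin) //.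
by have := H (inord i); rewrite inordK ?ltnS ?(ltnW ltin) // addn1 ltin => /eqP.
Qed.

(** * Degree bounds for symmetric and for bounded functions *)

Section Bounds.
Variable R : realType.

(** Tripling L absorbs the factor 2 that the use of two counters costs. *)
Lemma expR_triple (L : R) : 1 / 2 <= L -> 2 * expR (- (3 * L)) <= expR (- L).
Proof.
move=> L2; have -> : - (3 * L) = - L + - (2 * L) by ring.
rewrite expRD mulrCA -[X in _ <= X]mulr1 ler_wpM2l ?expR_ge0 // expRN.
by rewrite ler_pdivrMr ?expR_gt0 // mul1r; have := expR_ge1Dx (2 * L); lra.
Qed.

Lemma symmetric_bound : exists C : R, 1 <= C /\
  forall (F : fieldType) n (f : boolfun n) (L : R), symmetric_fun f -> 1 / 2 <= L ->
  exists d : nat, d%:R <= C * Num.sqrt (n%:R * L) /\ approximates F (expR (- L)) f d.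
Proof.
pose b : R := 100 * 100; have b1 : 1 <= b by rewrite /b; lra.
pose K := 300 * b; have K1 : 1 <= K by rewrite /K; lra.
exists (3 * K); split; first by lra.
move=> F n f L symf L2; have L0 : 0 <= L by lra.
have s0 := sqrtr_ge0 (n%:R * L).
(* For n < L, exact interpolation has degree n <= sqrt (n L). Otherwise L <= sqrt (n L) absorbs the
   summand L of the descent. *)
have [nL|Ln] := ltP n%:R L.
  exists n; split; last exact/approximates_symmetric/counter_exact/expR_ge0.
  apply: (@le_trans _ _ (Num.sqrt (n%:R * L))); last by rewrite ler_peMl //; lra.
  apply: le_of_sqr => //; rewrite sqr_sqrtr ?mulr_ge0 ?ler0n //.
  by rewrite expr2 ler_wpM2l ?ler0n // ltW.
(* The invariant m < k survives halving, so once k = O(L) the list has O(L) literals and exact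
   interpolation suffices. *)
have base k m (L' : R) : 1 / 2 <= L' -> k%:R <= 100 * (100 * L') -> (m < k)%N ->
    exists d : nat, d%:R <= b * L' /\ counter F n k m (expR (- L')) d.
  move=> _ kL mk; exists m; split; last exact/counter_exact/expR_ge0.
  by rewrite /b -mulrA; apply: le_trans kL; rewrite ler_nat ltnW.
have half_lt k k' m : (m < k)%N -> (k < 2 * k')%N -> (uphalf m < k')%N.
  by move=> mk kk; rewrite ltn_uphalf_double -mul2n; apply: leq_trans kk; rewrite ltnS.
have [d [dle cd]] := descent half_lt b1 base L2 (ltnSn n).
exists d; split; last exact: approximates_symmetric.
have nL0 : 0 <= n%:R * L by rewrite mulr_ge0 ?ler0n.
have s1 : Num.sqrt (n.+1%:R * L) <= 2 * Num.sqrt (n%:R * L).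
  apply: le_of_sqr; first by lra.
  rewrite exprMn !sqr_sqrtr ?mulr_ge0 ?ler0n //.
  have n1 : 1 <= n%:R :> R.
    by rewrite ler1n lt0n; apply: contraTN Ln => /eqP ->; rewrite -ltNge; lra.
  by rewrite -natr1 mulrDl mul1r; nra.
have s2 : L <= Num.sqrt (n%:R * L).
  apply: le_of_sqr => //; by rewrite sqr_sqrtr // expr2 ler_wpM2r.
apply: le_trans dle _; rewrite -/K; set s := Num.sqrt (n%:R * L) in s0 s1 s2 *.
have -> : 3 * K * s = K * (3 * s) by ring.
by apply: ler_wpM2l; lra.
Qed.

Lemma polylog_ge1 c n : (0 < n)%N -> 1 <= polylog R c n.
Proof.
move=> n0; rewrite /polylog; apply: exprn_ege1.
by rewrite lerDl ln_ge0 // ler1n.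
Qed.

Lemma ln2_ge : 1 / 2 <= ln (2 : R).
Proof.
rewrite -[X in X <= _]expRK ler_ln ?posrE ?expR_gt0 //.
by have := @expR_half_le R 1; rewrite -natr1 addrC; apply; rewrite ler01 lexx.
Qed.

(** For p = 0 the exponent is 2: about log n halvings cost O(L + log n) each. For p > 0 the vote
    needs no logarithm. *)
Lemma counter_base (p : nat) : exists (Cb : R) (c : nat), 1 <= Cb /\ ((0 < p)%N -> c = 0%N) /\
  forall F : fieldType, has_characteristic F p -> forall n, (0 < n)%N ->
  forall k m (L : R), 1 / 2 <= L -> k%:R <= 100 * (100 * L) -> (m <= n)%N ->
  exists d : nat, d%:R <= Cb * polylog R c n * L /\ counter F n k m (expR (- L)) d.
Proof.
case: p => [|p].
  exists (300 * (100 * 16)), 2; split; first by lra.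
  split=> // F _ n n0 k m L L2 kL mn; pose r := (trunc_log 2 n).+1.
  have [//|d [dL cd]] := @base_by_halving R F n n r isT _ k m L L2 kL mn.
    by rewrite ltnW // trunc_log_ltn.
  exists d; split=> //; apply: le_trans dL _; rewrite ler_wpM2r //; first by lra.
  rewrite -!mulrA ler_wpM2l // ler_wpM2l //.
  have -> : 16 = 4 ^+ 2 :> R by ring.
  rewrite /polylog -exprMn.
  have ln0 : 0 <= ln (n%:R : R) by rewrite ln_ge0 // ler1n.
  have h : (r.-1)%:R / 2 <= ln (n%:R : R).
    apply: (@le_trans _ _ (ln (2 : R) *+ r.-1)).
      by rewrite -[ln _ *+ _]mulr_natl ler_wpM2l ?ler0n //; have := ln2_ge; lra.
    rewrite -lnXn // ler_ln ?posrE ?exprn_gt0 ?ltr0n //.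
    by rewrite -natrX ler_nat /r /=; apply: trunc_logP.
  rewrite lerXn2r ?nnegrE ?ler0n //; first by lra.
  by rewrite /r -natr1; rewrite /r /= in h; lra.
exists (100 * (100 * 100) + 32 * p.+1%:R), 0%N; split.
  by have := ler0n R p.+1; lra.
split=> // F charF n n0 k m L L2 kL mn.
by rewrite /polylog expr0 mulr1; apply: base_prime_char.
Qed.

Lemma bounded_bound (p : nat) : exists (C : R) (c : nat), 1 <= C /\ ((0 < p)%N -> c = 0%N) /\
  forall F : fieldType, has_characteristic F p ->
  forall n (h : boolfun n) k (L : R), (0 < n)%N -> symmetric_fun h -> bounded h k -> 1 / 2 <= L ->
  exists d : nat, d%:R <= C * polylog R c n * (Num.sqrt (k%:R * L) + L) /\
    approximates F (expR (- L)) h d.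
Proof.
have [C1 [C11 sym]] := symmetric_bound; have [Cb [c [Cb1 [c0 base]]]] := counter_base p.
exists (900 * Cb + 2 * C1), c; split; first by lra.
split=> // F charF n h k L n0 symh bh L2; have pl := polylog_ge1 c n0.
have L0 : 0 <= L by lra.
have s0 := sqrtr_ge0 (k%:R * L).
(* If 2 k > n, then sqrt (n L) <= sqrt (2 k L), and the bound for symmetric functions is good
   enough. *)
have [kn|nk] := leqP (2 * k) n; last first.
  have [d [dL ad]] := sym F n h L symh L2; exists d; split=> //; apply: le_trans dL _.
  have s1 : Num.sqrt (n%:R * L) <= 2 * Num.sqrt (k%:R * L).
    apply: le_of_sqr; first by lra.
    rewrite exprMn !sqr_sqrtr ?mulr_ge0 ?ler0n //.
    have : n%:R <= 2 * k%:R :> R by rewrite -natrM ler_nat ltnW.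
    by have := ler0n R k; nra.
  apply: (@le_trans _ _ (C1 * (2 * (Num.sqrt (k%:R * L) + L)))).
    by rewrite ler_wpM2l //; lra.
  rewrite mulrA ler_wpM2r //; first by lra.
  by apply: (@le_trans _ _ (C1 * 2 * polylog R c n)); [rewrite ler_peMr|rewrite ler_wpM2r]; lra.
have Cpl1 : 1 <= Cb * polylog R c n by rewrite mulr_ege1.
have hcond (k0 k1 m : nat) : (m <= n)%N -> (k0 < 2 * k1)%N -> (uphalf m <= n)%N.
  by move=> mn _; apply: leq_trans mn; rewrite leq_uphalf_double -mul2n leq_pmull.
have L3 : 1 / 2 <= 3 * L by lra.
have [d [dL cd]] := @descent R F n (fun _ m => (m <= n)%N) _ hcond Cpl1
  (base F charF n n0) k n _ L3 (leqnn n).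
exists d; split; last first.
  apply: approximates_weaken (expR_triple L2) (leqnn d) _.
  exact: approximates_bounded kn cd.
have s3 : Num.sqrt (k%:R * (3 * L)) <= 3 * Num.sqrt (k%:R * L).
  apply: le_of_sqr; first by lra.
  have kL0 : 0 <= k%:R * L by rewrite mulr_ge0 ?ler0n.
  rewrite exprMn mulrCA !sqr_sqrtr //; last by rewrite mulr_ge0 ?ler0n.
  by rewrite ler_wpM2r // expr2 ler_peMr //; lra.
apply: le_trans dL _.
set q := polylog R c n in pl Cpl1 *; set s := Num.sqrt _ in s0 s3 *.
apply: (@le_trans _ _ (300 * (Cb * q) * (3 * (s + L)))).
  by rewrite ler_wpM2l //; lra.
have -> : 300 * (Cb * q) * (3 * (s + L)) = 900 * Cb * q * (s + L) by ring.
rewrite ler_wpM2r //; first by lra.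
by rewrite ler_wpM2r //; lra.
Qed.

End Bounds.

(* The exponent c of the polylogarithmic factor is 0 when p > 0, so that every
   bound below is then an O(.) bound. *)
Theorem theorem1p3 (R : realType) (p : nat) :
  exists (C : R) (c : nat),
    0 < C /\ ((0 < p)%N -> c = 0%N) /\
    forall (F : fieldType), has_characteristic F p ->
    forall (n : nat) (f g h : boolfun n) (eps : R),
      symmetric_fun f -> standard_decomposition f g h -> 0 < eps ->
      let L := log_inv eps in
      let pd (u : boolfun n) := pdeg F eps u in
      let case1 := (1 < per g)%N /\ ~ is_power_of p (per g) in
      let case2 := is_power_of p (per g) /\ Bd h = 0%N in
      [/\ (per g = 1%N -> pd g = 0%N) /\
          (is_power_of p (per g) -> (pd g <= per g)%N),
          ((1 <= Bd h)%N ->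
             (pd h)%:R <= C * polylog R c n * (Num.sqrt ((Bd h)%:R * L) + L)) /\
          (~ (1 <= Bd h)%N -> pd h = 0%N)
        & [/\ case1 -> (pd f)%:R <= C * Num.sqrt (n%:R * L),
              case2 -> (pd f)%:R <= C * Num.min (Num.sqrt (n%:R * L)) (per g)%:R
            & ~ case1 -> ~ case2 ->
              (pd f)%:R <= C * polylog R c n *
                Num.min (Num.sqrt (n%:R * L))
                        ((per g)%:R + Num.sqrt ((Bd h)%:R * L) + L)]].
Proof.
have [C1 [C11 sym]] := symmetric_bound R; have [C2 [c [C21 [c0 bnd]]]] := bounded_bound R p.
exists (C1 + C2), c; split; first by lra.
split=> // F charF n f g h eps symf [symg _ _ hE] eps0 L pd case1 case2.
have e0 := ltW eps0.
have fE a : f a = g a (+) h a by rewrite hE ffunE addbC -addbA addbb addbF.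
have symh : symmetric_fun h by move=> a b ab; rewrite hE !ffunE (symf a b) ?(symg a b).
have perg := per_is_period g; have bh := bounded_Bd h.
have per0 : (0 < per g)%N by case/andP: perg.
(* For n = 0 the spectrum is a single point and B(h) = 0; n > 0 makes the polylogarithmic factor at
   least 1. *)
have n_pos : (0 < Bd h)%N -> (0 < n)%N.
  rewrite !lt0n; apply: contraNneq => n0; rewrite -leqn0 /Bd.
  case: ex_minnP => m _; apply; apply/forallP => i; apply/forallP => j.
  have lt0 (i' : 'I_n.+1) : i' = 0%N :> nat.
    by apply/eqP; rewrite -leqn0 -n0 -ltnS.
  by rewrite (lt0 i) (lt0 j) eqxx !implybT.
have g_cst : per g = 1%N -> degle 0 (fun a => (g a)%:R : F).
  by move=> g1; apply: degle_constant => // i; apply: period1_constant; rewrite -g1.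
have h_cst : Bd h = 0%N -> degle 0 (fun a => (h a)%:R : F).
  move=> h0; apply: degle_constant => // i lein; rewrite h0 in bh.
  by apply: (boundedP bh); rewrite subn0.
have g_pow : is_power_of p (per g) -> degle (per g) (fun a => (g a)%:R : F).
  (* For p = 0 the only positive power is 0^0 = 1, so g is constant. *)
  move=> [k kE]; have [p0|p0] := posnP p; last first.
    have charFp : p \in [pchar F] by move: charF p0; rewrite /has_characteristic; case: (p).
    by rewrite kE; apply: (degle_periodic charFp) => //; rewrite -kE.
  apply: degle_leq (g_cst _) => //; move: per0; rewrite kE p0.
  by case: k {kE} => // k; rewrite exp0n.
have pdle u d : approximates F eps u d -> (pd u <= d)%N by apply: pdeg_approximates.
have L0 : 0 <= L by rewrite /L /log_inv le_max lexx.
have Cpl m : 0 <= (C1 + C2) * polylog R c m.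
  rewrite mulr_ge0 //; first by lra.
  case: m => [|m]; last by apply: le_trans (polylog_ge1 R c (ltn0Sn m)).
  (* At n = 0 the logarithm has default value 0, so the factor is 1. *)
  by rewrite /polylog ln0 // addr0 expr1n.
have sq m : 0 <= Num.sqrt (m%:R * L) by apply: sqrtr_ge0.
(* For such eps, L can be 0 or close to it, so only degree 0 fits the bounds; a random constant
   achieves it. *)
have [eps2|eps2] := lerP (1 / 2) eps.
  have pd0 u : pd u = 0%N.
    by apply/eqP; rewrite -leqn0; apply/pdle/approximates_coin.
  split; last split.
  - by split=> _; rewrite pd0.
  - by split=> [_|_]; rewrite pd0 // mulr_ge0 // addr_ge0.
  - by move=> _; rewrite pd0 mulr_ge0 //; lra.
  - by move=> _; rewrite pd0 mulr_ge0 //; [lra|rewrite le_min sq ler0n].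
  - by move=> _ _; rewrite pd0 mulr_ge0 // le_min sq !addr_ge0.
have LE : L = - ln eps.
  rewrite /L /log_inv lnV ?posrE //; apply/max_idPr.
  by rewrite oppr_ge0 ln_le0 //; lra.
have L2 : 1 / 2 <= L.
  have ln_eps : ln eps <= ln (2^-1 : R) by rewrite ler_ln ?posrE ?invr_gt0 //; lra.
  by rewrite lnV ?posrE // in ln_eps; have := ln2_ge R; rewrite LE; lra.
have expL : expR (- L) = eps by rewrite LE opprK lnK // posrE.
rewrite -{}expL in pdle.
have pdf : (pd f)%:R <= C1 * Num.sqrt (n%:R * L).
  have [d [dL ad]] := sym F n f L symf L2; apply: le_trans dL.
  by rewrite ler_nat; apply: pdle.
have pdf_C : (pd f)%:R <= (C1 + C2) * Num.sqrt (n%:R * L).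
  by apply: le_trans pdf _; rewrite ler_wpM2r //; lra.
split; last split.
- split=> [g1|gp]; last exact/pdle/approximates_exact/g_pow/gp/expR_ge0.
  by apply/eqP; rewrite -leqn0; apply/pdle/approximates_exact/g_cst/g1/expR_ge0.
- split=> [h1|h0]; last first.
    apply/eqP; rewrite -leqn0; apply/pdle/approximates_exact/h_cst; first exact: expR_ge0.
    by apply/eqP; rewrite -leqn0 leqNgt; apply/negP.
  have [d [dL ad]] := bnd F charF n h (Bd h) L (n_pos h1) symh bh L2.
  apply: (@le_trans _ _ d%:R); first by rewrite ler_nat; apply: pdle.
  apply: le_trans dL _; rewrite -!mulrA ler_wpM2r //; last by lra.
  rewrite mulr_ge0 ?addr_ge0 //; apply: le_trans (polylog_ge1 R c (n_pos h1)); exact: ler01.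
- by [].
- move=> [gp h0]; have pdg : (pd f)%:R <= (C1 + C2) * (per g)%:R.
    apply: (@le_trans _ _ (per g)%:R); last by rewrite ler_peMl //; lra.
    rewrite ler_nat -[per g]addn0; apply/pdle/(approximates_xor fE (g_pow gp)).
    exact/approximates_exact/h_cst/h0/expR_ge0.
  by rewrite /Num.min; case: ifP.
move=> nc1 nc2.
(* Outside the first case [per g] is a power of p, the value 1 being p^0; outside the second, B(h) >
   0 follows. *)
have gp : is_power_of p (per g).
  apply: contrapT => ngp; apply: nc1; split=> //.
  rewrite ltn_neqAle per0 andbT; apply/eqP => g1; apply: ngp; exists 0%N; by rewrite expn0 -g1.
have h1 : (0 < Bd h)%N by rewrite lt0n; apply/eqP => h0; apply: nc2.
have pl := polylog_ge1 R c (n_pos h1).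
have CC : 0 <= C1 + C2 by lra.
have bd1 : (pd f)%:R <= (C1 + C2) * polylog R c n * Num.sqrt (n%:R * L).
  by apply: le_trans pdf_C _; rewrite ler_wpM2r // ler_peMr.
have bd2 : (pd f)%:R <=
    (C1 + C2) * polylog R c n * ((per g)%:R + Num.sqrt ((Bd h)%:R * L) + L).
  have [d [dL ad]] := bnd F charF n h (Bd h) L (n_pos h1) symh bh L2.
  apply: (@le_trans _ _ ((per g)%:R + d%:R)).
    by rewrite -natrD ler_nat; apply/pdle/(approximates_xor fE (g_pow gp)).
  rewrite -addrA mulrDr; apply: lerD.
    by rewrite ler_peMl // mulr_ege1 //; lra.
  apply: le_trans dL _; rewrite ler_wpM2r ?addr_ge0 // ler_wpM2r //; lra.
by rewrite /Num.min; case: ifP.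
Qed.
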